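(* Let $0<\alpha\le 1$ and suppose that $\lambda<0$ and $\rho\le 0$ are real. Let $p\in\{1,2\}$, $q\in\{1,2\}$, and let $\omega(p,\alpha,1,z)=\sum_{n\ge 0}\omega^{(\alpha)}_n z^n$ be either the fractional backward difference generating function or the generalized Newton--Gregory generating function of order $p$ (both given in the context). Then the method $$\frac{1}{\tau^{\alpha}}\sum_{j=0}^{n}\omega^{(\alpha)}_{n-j}(U_j-U_0)=(\lambda+\rho)U_n-(\rho+\kappa)E^n_q(U),\qquad n\ge q,$$ is unconditionally stable if the real constant $\kappa$ satisfies $$\kappa>\begin{cases}\dfrac{\lambda-\rho}{2}, & q=1,\\[2mm] \dfrac{\lambda-3\rho}{4}, & q=2.\end{cases}$$
   Context: The method discretizes the model problem ${}_{C}D^{\alpha}_{0,t}u(t)=(\lambda+\rho)u(t)$ with Caputo derivative of order $\alpha$; $U_n$ approximates $u(n\tau)$, where $\tau>0$ is the step size. Generating functions. Fractional backward difference formula of order $p$: $\omega(p,\alpha,1,z)=\left(\sum_{k=1}^p\frac1k(1-z)^k\right)^{\alpha}$. Generalized Newton--Gregory formula of order $p$: $\omega(1,\alpha,1,z)=(1-z)^{\alpha}$ and $\omega(2,\alpha,1,z)=(1-z)^{\alpha}\left(1+\frac{\alpha}{2}(1-z)\right)$. The powers are the analytic branches on $|z|<1$ that are positive at $z=0$, extended continuously to $|z|\le 1$; $\omega^{(\alpha)}_n$ are the Taylor coefficients at $z=0$. Perturbation: $E^n_1(U)=U_n-U_{n-1}$ and $E^n_2(U)=U_n-2U_{n-1}+U_{n-2}$.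 Unconditionally stable means stable for every step size $\tau>0$, where stable means: for arbitrary starting values ($U_0$ if $q=1$; $U_0,U_1$ if $q=2$), the numerical solution satisfies $U_n\to 0$ as $n\to\infty$. In the paper this is established via the stability set $$\mathbb{S}=\mathbb{C}\setminus\left\{\xi\ \Big|\ \xi^{\alpha}=\frac{\omega(p,\alpha,1,z)}{(\lambda+\rho)-(\rho+\kappa)(1-z)^q}\ \text{ for some } |z|\le 1\right\},$$ the method being stable for $\tau$ whenever $\tau\in\mathbb{S}$; here $\tau\in\mathbb{S}$ is understood as $\omega(p,\alpha,1,z)-\tau^{\alpha}\left[(\lambda+\rho)-(\rho+\kappa)(1-z)^q\right]\ne 0$ for all $|z|\le 1$, and unconditional stability corresponds to $(0,\infty)\subset\mathbb{S}$. *)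

(* Defs.v *)
From Stdlib Require Export Reals.
From Coquelicot Require Export Coquelicot.

Open Scope R_scope.

Definition Cexp (z : C) : C :=
  (exp (Re z) * cos (Im z), exp (Re z) * sin (Im z)).

(* On |z| < 1, [F] is the analytic branch of [b ^ alpha], positive at z = 0;
   [L] is a holomorphic logarithm of [b]. *)
Definition is_power_branch (b : C -> C) (alpha : R) (F : C -> C) : Prop :=
  (exists L : C -> C, forall z : C, Cmod z < 1 ->
     ex_derive (K := C_AbsRing) (V := C_NormedModule) L z /\
     Cexp (L z) = b z /\
     F z = Cexp (RtoC alpha * L z)%C) /\
  (exists r : R, 0 < r /\ F (RtoC 0) = RtoC r).

Inductive gen_family : Set :=
| FractionalBDF
| NewtonGregory.

Definition bdf_base (p : nat) (z : C) : C :=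
  sum_n_m (fun k : nat => (RtoC (/ INR k) * (RtoC 1 - z) ^ k)%C) 1 p.

(* The Newton-Gregory formula is only given for orders 1 and 2; other orders
   get an arbitrary value. *)
Definition ng_factor (p : nat) (alpha : R) (z : C) : C :=
  match p with
  | 1%nat => RtoC 1
  | 2%nat => (RtoC 1 + RtoC (alpha / 2) * (RtoC 1 - z))%C
  | _ => RtoC 0
  end.

(* [omega] is, on the open unit disc, the generating function
   omega(p, alpha, 1, .) of the given family. *)
Definition is_generating_function
    (fam : gen_family) (p : nat) (alpha : R) (omega : C -> C) : Prop :=
  match fam with
  | FractionalBDF => is_power_branch (bdf_base p) alpha omega
  | NewtonGregory =>
      exists G : C -> C,
        is_power_branch (fun z => (RtoC 1 - z)%C) alpha G /\
        forall z : C, Cmod z < 1 -> omega z = (G z * ng_factor p alpha z)%C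
  end.

Definition are_taylor_coefficients (omega : C -> C) (w : nat -> C) : Prop :=
  forall z : C, Cmod z < 1 ->
    is_pseries (K := C_AbsRing) (V := C_NormedModule) w z (omega z).

(* The perturbation E^n_q; used only for q in {1, 2} and n >= q, so the
   truncated subtractions are harmless. *)
Definition perturbation (q n : nat) (U : nat -> C) : C :=
  match q with
  | 1%nat => (U n - U (n - 1)%nat)%C
  | 2%nat => (U n - RtoC 2 * U (n - 1)%nat + U (n - 2)%nat)%C
  | _ => RtoC 0
  end.

Definition satisfies_method (q : nat) (alpha lambda rho kappa : R)
    (w : nat -> C) (tau : R) (U : nat -> C) : Prop :=
  forall n : nat, (q <= n)%nat ->
    (RtoC (/ Rpower tau alpha) *
       sum_n (fun j : nat => w (n - j)%nat * (U j - U 0%nat)) n)%C =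
    (RtoC (lambda + rho) * U n - RtoC (rho + kappa) * perturbation q n U)%C.

Definition numerical_solution (q : nat) (alpha lambda rho kappa : R)
    (w : nat -> C) (tau : R) (start U : nat -> C) : Prop :=
  (forall i : nat, (i < q)%nat -> U i = start i) /\
  satisfies_method q alpha lambda rho kappa w tau U.

(* Only the values [start i] for i < q matter.  The method is implicit, so
   that a numerical solution exists is part of the claim. *)
Definition stable (q : nat) (alpha lambda rho kappa : R)
    (w : nat -> C) (tau : R) : Prop :=
  forall start : nat -> C,
    (exists U : nat -> C,
       numerical_solution q alpha lambda rho kappa w tau start U) /\
    (forall U : nat -> C,
       numerical_solution q alpha lambda rho kappa w tau start U ->
       filterlim U eventually (locally (RtoC 0))).

Definition unconditionally_stable (q : nat) (alpha lambda rho kappa : R)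
    (w : nat -> C) : Prop :=
  forall tau : R, 0 < tau -> stable q alpha lambda rho kappa w tau.

(* Main.v *)
Require Import Defs.
From Stdlib Require Import Reals Lra Lia Psatz.
From Coquelicot Require Import Coquelicot.
Open Scope R_scope.

(* The method reads d * U = f, where d is the coefficient sequence of the symbol
   d(z) = omega(z) - tau^alpha ((lambda + rho) - (rho + kappa) (1 - z)^q) and
   f_n = U_0 (w_0 + ... + w_n) tends to 0 because omega(1) = 0.  It suffices that
   the formal inverse of d is absolutely summable.

   Since omega and omega / (1 - z) map the disc to the right half-plane, either d
   or d / (1 + eps - z) has real part bounded below by a positive constant; the
   division is needed when q = 2 and rho + kappa > 0.  Such a series D is coercive
   on l^2, by Parseval at roots of unity, which gives l^2 bounds for 1/D and for
   the differences of 1/D and its rotations.  As the coefficients of omega are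
   O(n^(-1-alpha)), Bernstein's dyadic argument turns these bounds into the
   summability of the coefficients of 1/D. *)

(** Nonvanishing of d on the closed disc would call for Wiener's inversion theorem; a positive lower
    bound on a real part allows the elementary l^2 argument instead. An l^2 bound on 1/d would not
    be enough: for alpha < 1 the forcing f_n is of order n^(-alpha), not square summable when alpha
    <= 1/2, so the inverse has to be in l^1. Near z = 1 the symbol is in general only Hölder of
    exponent alpha, so Bernstein's criterion for exponents above 1/2 does not cover small alpha. The
    coefficient decay still gives an l^2 modulus of continuity of order h^((1 + alpha)/2), which
    beats the critical h^(1/2) for every alpha > 0. With mu = -(lambda + rho) > 0 and k = rho +
    kappa, the condition on kappa says that mu + k (1 - z)^q is positive at z = -1, its worst point
    when k <= 0. The shift eps in 1 + eps - z is there because 1/(1 - z) has constant coefficients,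
    whereas those of 1/(1 + eps - z) decay geometrically and preserve the power law of d. *)

(* Coquelicot's sums have values in a canonical carrier, which [ring] does not
   recognise as [C] or [R]. *)
Ltac carrier_ring := match goal with |- @eq _ ?x ?y =>
  first [change (@eq C x y); ring | change (@eq R x y); ring] end.

(** * Finite sums of complex and real sequences *)

Lemma Csum_S (a : nat -> C) (n : nat) : sum_n a (S n) = (sum_n a n + a (S n))%C.
Proof. exact (sum_Sn a n). Qed.

Lemma Csum_shift (a : nat -> C) (n : nat) :
  sum_n a (S n) = (a 0%nat + sum_n (fun k => a (S k)) n)%C.
Proof.
  induction n as [|n IH].
  - now rewrite Csum_S, !sum_O.
  - rewrite Csum_S, IH, Csum_S. carrier_ring.
Qed.

Lemma Csum_plus (a b : nat -> C) (n : nat) :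
  sum_n (fun k => (a k + b k)%C) n = (sum_n a n + sum_n b n)%C.
Proof. exact (sum_n_plus a b n). Qed.

Lemma Csum_scal (c : C) (a : nat -> C) (n : nat) :
  sum_n (fun k => (c * a k)%C) n = (c * sum_n a n)%C.
Proof. exact (sum_n_mult_l (K := C_Ring) c a n). Qed.

Lemma Csum_Re (a : nat -> C) (n : nat) :
  Re (sum_n a n) = sum_n (fun k => Re (a k)) n.
Proof.
  induction n as [|n IH]; [now rewrite !sum_O|].
  rewrite Csum_S, sum_Sn, <- IH. reflexivity.
Qed.

Lemma Csum_Im (a : nat -> C) (n : nat) :
  Im (sum_n a n) = sum_n (fun k => Im (a k)) n.
Proof.
  induction n as [|n IH]; [now rewrite !sum_O|].
  rewrite Csum_S, sum_Sn, <- IH. reflexivity.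
Qed.

Lemma Csum_RtoC (a : nat -> R) (n : nat) :
  sum_n (fun k => RtoC (a k)) n = RtoC (sum_n a n).
Proof.
  induction n as [|n IH]; [now rewrite !sum_O|].
  rewrite Csum_S, sum_Sn, IH, <- RtoC_plus. reflexivity.
Qed.

Lemma Csum_Cmod (a : nat -> C) (n : nat) :
  Cmod (sum_n a n) <= sum_n (fun k => Cmod (a k)) n.
Proof.
  induction n as [|n IH]; [rewrite !sum_O; lra|].
  rewrite Csum_S, sum_Sn. unfold plus; simpl.
  eapply Rle_trans; [apply Cmod_triangle | apply Rplus_le_compat_r, IH].
Qed.

Lemma Csum_zero (a : nat -> C) (n : nat) :
  (forall k, (k <= n)%nat -> a k = RtoC 0) -> sum_n a n = RtoC 0.
Proof.
  intros H. induction n as [|n IH].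
  - rewrite sum_O. apply H; lia.
  - rewrite Csum_S, IH, H; [carrier_ring | lia | intros; apply H; lia].
Qed.

Lemma Rsum_S (a : nat -> R) (n : nat) : sum_n a (S n) = sum_n a n + a (S n).
Proof. exact (sum_Sn a n). Qed.

Lemma Rsum_scal (c : R) (a : nat -> R) (n : nat) :
  sum_n (fun k => c * a k) n = c * sum_n a n.
Proof. exact (sum_n_mult_l (K := R_Ring) c a n). Qed.

Lemma Rsum_plus (a b : nat -> R) (n : nat) :
  sum_n (fun k => a k + b k) n = sum_n a n + sum_n b n.
Proof. exact (sum_n_plus a b n). Qed.

Lemma Rsum_le (a b : nat -> R) (n : nat) :
  (forall k, (k <= n)%nat -> a k <= b k) -> sum_n a n <= sum_n b n.
Proof.
  intros H. induction n as [|n IH].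
  - rewrite !sum_O. apply H; lia.
  - rewrite !Rsum_S. apply Rplus_le_compat; [apply IH; intros; apply H; lia | apply H; lia].
Qed.

Lemma Rsum_nonneg (a : nat -> R) (n : nat) :
  (forall k, (k <= n)%nat -> 0 <= a k) -> 0 <= sum_n a n.
Proof.
  intros H. induction n as [|n IH].
  - rewrite sum_O. apply H; lia.
  - rewrite Rsum_S. apply Rplus_le_le_0_compat; [apply IH; intros; apply H; lia | apply H; lia].
Qed.

Lemma Rsum_incr (a : nat -> R) (n m : nat) :
  (forall k, 0 <= a k) -> (n <= m)%nat -> sum_n a n <= sum_n a m.
Proof.
  intros H Hnm. induction Hnm as [|m _ IH]; [lra|].
  rewrite Rsum_S. specialize (H (S m)). lra.
Qed.

(** * Convolution of sequences *)

(** Recursion on the shift of the first factor lets the algebraic laws follow by plain induction;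
    [conv_sum] recovers the usual Cauchy product. *)
Fixpoint conv (a b : nat -> C) (n : nat) : C :=
  match n with
  | O => (a 0%nat * b 0%nat)%C
  | S k => (a 0%nat * b (S k) + conv (fun i => a (S i)) b k)%C
  end.

Definition delta0 (n : nat) : C := match n with O => 1%C | S _ => 0%C end.

Lemma conv_ext (a a' b b' : nat -> C) (n : nat) :
  (forall k, (k <= n)%nat -> a k = a' k) ->
  (forall k, (k <= n)%nat -> b k = b' k) ->
  conv a b n = conv a' b' n.
Proof.
  revert a a'. induction n as [|n IH]; intros a a' Ha Hb; simpl.
  - now rewrite Ha, Hb by lia.
  - rewrite (Ha 0%nat), (Hb (S n)) by lia. f_equal.
    apply IH; intros; [apply Ha | apply Hb]; lia.
Qed.

Lemma conv_sum (a b : nat -> C) (n : nat) :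
  conv a b n = sum_n (fun j => (a j * b (n - j)%nat)%C) n.
Proof.
  revert a. induction n as [|n IH]; intros a.
  - now rewrite sum_O.
  - rewrite Csum_shift. simpl. now rewrite IH.
Qed.

Lemma conv_plus_l (a a' b : nat -> C) (n : nat) :
  conv (fun k => (a k + a' k)%C) b n = (conv a b n + conv a' b n)%C.
Proof.
  revert a a'. induction n as [|n IH]; intros a a'; simpl; [ring|].
  rewrite (IH (fun i => a (S i)) (fun i => a' (S i))). ring.
Qed.

Lemma conv_scal_l (c : C) (a b : nat -> C) (n : nat) :
  conv (fun k => (c * a k)%C) b n = (c * conv a b n)%C.
Proof.
  revert a. induction n as [|n IH]; intros a; simpl; [ring|].
  rewrite (IH (fun i => a (S i))). ring.
Qed.

Lemma conv_last (a b : nat -> C) (n : nat) :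
  conv a b (S n) = (conv a (fun i => b (S i)) n + a (S n) * b 0%nat)%C.
Proof.
  revert a. induction n as [|n IH]; intros a; [reflexivity|].
  change (conv a b (S (S n)))
    with (a 0%nat * b (S (S n)) + conv (fun i => a (S i)) b (S n))%C.
  rewrite IH. simpl. ring.
Qed.

Lemma conv_comm (a b : nat -> C) (n : nat) : conv a b n = conv b a n.
Proof.
  revert a b. induction n as [|n IH]; intros a b; [simpl; ring|].
  rewrite conv_last. simpl. rewrite (IH a). ring.
Qed.

Lemma conv_assoc (a b c : nat -> C) (n : nat) :
  conv (conv a b) c n = conv a (conv b c) n.
Proof.
  revert a. induction n as [|n IH]; intros a; [simpl; ring|].
  simpl. rewrite (conv_plus_l (fun i => (a 0%nat * b (S i))%C)).
  rewrite (conv_scal_l (a 0%nat) (fun i => b (S i))), IH. ring.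
Qed.

Lemma conv_delta_l (a : nat -> C) (n : nat) : conv delta0 a n = a n.
Proof.
  destruct n as [|n]; simpl; [ring|].
  rewrite conv_sum, Csum_zero; [ring|]. intros; simpl; ring.
Qed.

Lemma conv_rotate (e : C) (a b : nat -> C) (n : nat) :
  conv (fun k => (a k * e ^ k)%C) (fun k => (b k * e ^ k)%C) n = (conv a b n * e ^ n)%C.
Proof.
  rewrite !conv_sum, (Cmult_comm (sum_n _ n)), <- Csum_scal.
  apply sum_n_ext_loc. intros k Hk.
  replace (e ^ n)%C with (e ^ k * e ^ (n - k))%C; [carrier_ring|].
  rewrite <- Cpow_add_r. f_equal. lia.
Qed.

Lemma conv_Cmod (a b : nat -> C) (n : nat) :
  Cmod (conv a b n) <= sum_n (fun j => Cmod (a j) * Cmod (b (n - j)%nat)) n.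
Proof.
  rewrite conv_sum. eapply Rle_trans; [apply Csum_Cmod|].
  apply Rsum_le. intros. rewrite Cmod_mult. lra.
Qed.

(* Only the values of [conv_prefix d f N] at indices up to [N] are meaningful. *)
Fixpoint conv_prefix (d f : nat -> C) (N : nat) : nat -> C :=
  match N with
  | O => fun _ => (f 0%nat / d 0%nat)%C
  | S k => fun n =>
      if Nat.leb n k then conv_prefix d f k n
      else ((f (S k) - conv (fun i => d (S i)) (conv_prefix d f k) k) / d 0%nat)%C
  end.

(** Forward substitution in a triangular system. The successive prefixes agree where they overlap,
    so their diagonal is the solution. *)
Lemma conv_solve (d f : nat -> C) :
  d 0%nat <> 0%C -> exists u, forall n, conv d u n = f n.
Proof.
  intros Hd. set (p := conv_prefix d f).
  assert (Hp : forall N n, (n <= N)%nat -> p N n = p n n).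
  { induction N as [|N IH]; intros n Hn.
    - now replace n with 0%nat by lia.
    - destruct (Nat.eq_dec n (S N)) as [->|Hne]; [reflexivity|].
      rewrite <- IH by lia. unfold p at 1; simpl.
      destruct (Nat.leb_spec n N); [reflexivity | lia]. }
  exists (fun n => p n n). intros [|n].
  - unfold p; simpl. field. exact Hd.
  - simpl conv.
    rewrite (conv_ext _ (fun i => d (S i)) _ (p n)); [|reflexivity|].
    2: { intros k Hk. now rewrite (Hp n). }
    replace (p (S n) (S n))
      with ((f (S n) - conv (fun i => d (S i)) (p n) n) / d 0%nat)%C.
    + field. exact Hd.
    + change (p (S n) (S n)) with (if Nat.leb (S n) n then p n (S n)
        else ((f (S n) - conv (fun i => d (S i)) (p n) n) / d 0%nat)%C).
      destruct (Nat.leb_spec (S n) n); [lia | reflexivity].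
Qed.

(** * Coercivity of triangular Toeplitz matrices *)

Definition cis (t : R) : C := (cos t, sin t).

Lemma cis_plus (s t : R) : cis (s + t) = (cis s * cis t)%C.
Proof.
  unfold cis, Cmult; simpl. rewrite cos_plus, sin_plus. f_equal; ring.
Qed.

Lemma cis_pow (t : R) (n : nat) : (cis t ^ n)%C = cis (INR n * t).
Proof.
  induction n as [|n IH].
  - simpl. unfold cis. rewrite Rmult_0_l, cos_0, sin_0. reflexivity.
  - rewrite Cpow_S, IH, <- cis_plus, S_INR. f_equal. ring.
Qed.

Lemma cis_conj (t : R) : Cconj (cis t) = cis (- t).
Proof. unfold cis, Cconj; simpl. now rewrite cos_neg, sin_neg. Qed.

Lemma cis_Cmod (t : R) : Cmod (cis t) = 1.
Proof.
  unfold Cmod, cis; simpl fst; simpl snd.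
  assert (H := sin2_cos2 t). unfold Rsqr in H.
  replace (cos t ^ 2 + sin t ^ 2) with 1 by (simpl; lra). apply sqrt_1.
Qed.

Lemma cis_2PI (n : nat) : cis (2 * PI * INR n) = RtoC 1.
Proof.
  unfold cis.
  replace (2 * PI * INR n) with (0 + 2 * INR n * PI) by ring.
  now rewrite cos_period, sin_period, cos_0, sin_0.
Qed.

Lemma geometric_Csum (x : C) (n : nat) :
  ((1 - x) * sum_n (fun k => x ^ k) n)%C = (1 - x ^ S n)%C.
Proof.
  induction n as [|n IH].
  - rewrite sum_O. simpl. ring.
  - rewrite Csum_S, Cmult_plus_distr_l, IH. rewrite (Cpow_S x (S n)). ring.
Qed.

Definition node (M k : nat) : C := cis (2 * PI / INR (S M) * INR k).

(** A geometric sum whose ratio is an (M + 1)-th root of unity. Since |l - m| <= M, the ratio equals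
    1 only when l = m. *)
Lemma node_orthogonal (M l m : nat) : (l <= M)%nat -> (m <= M)%nat ->
  sum_n (fun k => node M k ^ l * Cconj (node M k) ^ m)%C M =
  if Nat.eq_dec l m then RtoC (INR (S M)) else RtoC 0.
Proof.
  intros Hl Hm.
  assert (HM : 0 < INR (S M)) by (apply lt_0_INR; lia).
  set (x := (2 * PI / INR (S M) * (INR l - INR m))).
  assert (E : forall k, (node M k ^ l * Cconj (node M k) ^ m)%C = (cis x ^ k)%C).
  { intros k. unfold node. rewrite cis_conj, !cis_pow, <- cis_plus.
    unfold x. f_equal. ring. }
  rewrite (sum_n_ext _ _ _ E). clear E.
  destruct (Nat.eq_dec l m) as [->|Hne].
  - rewrite (sum_n_ext _ (fun _ => RtoC 1)).
    + rewrite Csum_RtoC. rewrite sum_n_const. f_equal. ring.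
    + intros k. rewrite cis_pow. unfold x, cis.
      replace (INR k * _) with 0 by ring. now rewrite cos_0, sin_0.
  - assert (G := geometric_Csum (cis x) M).
    assert (E : (cis x ^ S M)%C = RtoC 1).
    { rewrite cis_pow. unfold x.
      replace (INR (S M) * _) with (2 * PI * INR l + - (2 * PI * INR m)) by (field; lra).
      rewrite cis_plus, <- cis_conj, !cis_2PI.
      unfold RtoC, Cconj, Cmult; simpl. f_equal; ring. }
    rewrite E in G.
    (* 1 - cos x = 2 sin^2 (x/2), and x/2 = pi (l - m)/(M + 1) is nonzero and strictly between -pi
       and pi. *)
    assert (Hx : (1 - cis x)%C <> RtoC 0).
    { intros H. apply (f_equal Re) in H. simpl in H.
      set (y := x / 2).
      assert (Hc : cos x = 1 - 2 * sin y * sin y).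
      { rewrite <- cos_2a_sin. f_equal. unfold y. field. }
      assert (Hs : sin y <> 0).
      { assert (Hy : y = PI * ((INR l - INR m) / INR (S M))).
        { unfold y, x. field. lra. }
        assert (HP := PI_RGT_0).
        assert (Hl' := le_INR _ _ Hl). assert (Hm' := le_INR _ _ Hm).
        assert (Hl0 := pos_INR l). assert (Hm0 := pos_INR m).
        rewrite S_INR in *.
        assert (Hb : forall t, 0 < t -> t <= INR M -> 0 < t / (INR M + 1) < 1).
        { intros t H1 H2. split; [apply Rdiv_lt_0_compat; lra|].
          apply Rmult_lt_reg_r with (INR M + 1); [lra|].
          unfold Rdiv. rewrite Rmult_assoc, Rinv_l by lra. lra. }
        destruct (Nat.lt_ge_cases m l) as [Hlt|Hge].
        - apply lt_INR in Hlt. destruct (Hb (INR l - INR m)) as [H1 H2]; [lra|lra|].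
          apply Rgt_not_eq, sin_gt_0; rewrite Hy; nra.
        - assert (Hlt : (l < m)%nat) by lia. apply lt_INR in Hlt.
          destruct (Hb (INR m - INR l)) as [H1 H2]; [lra|lra|].
          assert (0 < sin (- y)).
          { assert (Hy' : - y = PI * ((INR m - INR l) / (INR M + 1))).
            { rewrite Hy. field. lra. }
            apply sin_gt_0; rewrite Hy'; nra. }
          rewrite sin_neg in H0. lra. }
      apply Hs. nra. }
    apply (f_equal (fun w => (/ (1 - cis x) * w)%C)) in G.
    rewrite Cmult_assoc, Cinv_l in G by exact Hx.
    rewrite Cmult_1_l in G. eapply eq_trans; [exact G | carrier_ring].
Qed.

Definition ev (a : nat -> C) (n : nat) (z : C) : C :=
  sum_n (fun l => (a l * z ^ l)%C) n.

Lemma ev_ext (a b : nat -> C) (n : nat) (z : C) :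
  (forall k, (k <= n)%nat -> a k = b k) -> ev a n z = ev b n z.
Proof.
  intros H. apply sum_n_ext_loc. intros k Hk. now rewrite H.
Qed.

Lemma ev_shift (a : nat -> C) (n : nat) (z : C) :
  ev a (S n) z = (a 0%nat + z * ev (fun i => a (S i)) n z)%C.
Proof.
  unfold ev. rewrite Csum_shift, <- Csum_scal. simpl (z ^ 0)%C. rewrite Cmult_1_r.
  f_equal. apply sum_n_ext. intros k. rewrite Cpow_S. carrier_ring.
Qed.

Lemma ev_trunc (a : nat -> C) (N M : nat) (z : C) :
  (forall k, (N < k)%nat -> a k = RtoC 0) -> (N <= M)%nat -> ev a M z = ev a N z.
Proof.
  intros H HNM. induction HNM as [|M HNM IH]; [reflexivity|].
  unfold ev in *. rewrite Csum_S, IH, H by lia. carrier_ring.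
Qed.

Lemma ev_plus (a b : nat -> C) (n : nat) (z : C) :
  ev (fun k => (a k + b k)%C) n z = (ev a n z + ev b n z)%C.
Proof.
  unfold ev. rewrite <- Csum_plus. apply sum_n_ext. intros; carrier_ring.
Qed.

Lemma ev_scal (c : C) (a : nat -> C) (n : nat) (z : C) :
  ev (fun k => (c * a k)%C) n z = (c * ev a n z)%C.
Proof.
  unfold ev. rewrite <- Csum_scal. apply sum_n_ext. intros; carrier_ring.
Qed.

Lemma ev_conv (Q u : nat -> C) (K N M : nat) (z : C) :
  (forall k, (K < k)%nat -> Q k = RtoC 0) ->
  (forall k, (N < k)%nat -> u k = RtoC 0) ->
  (K + N <= M)%nat ->
  ev (conv Q u) M z = (ev Q M z * ev u M z)%C.
Proof.
  revert Q M. induction K as [|K IH]; intros Q M HQ Hu HM.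
  - rewrite (ev_trunc Q 0 M) by (auto; lia).
    unfold ev at 2. rewrite sum_O. simpl (z ^ 0)%C. rewrite Cmult_1_r, <- ev_scal.
    apply ev_ext. intros k _.
    destruct k as [|k]; [reflexivity|]. simpl.
    rewrite conv_sum, Csum_zero; [ring|].
    intros j _. rewrite HQ by lia. ring.
  - destruct M as [|M]; [lia|].
    rewrite (ev_shift (conv Q u)). simpl conv.
    rewrite (ev_plus (fun i => (Q 0%nat * u (S i))%C)), ev_scal.
    rewrite (IH (fun i => Q (S i))); [|intros; apply HQ; lia|exact Hu|lia].
    rewrite (ev_shift Q), (ev_trunc u N M), <- (ev_trunc u N (S M)) by (auto; lia).
    rewrite (ev_shift u). ring.
Qed.

Lemma Csum_Cconj (a : nat -> C) (n : nat) :
  Cconj (sum_n a n) = sum_n (fun k => Cconj (a k)) n.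
Proof.
  induction n as [|n IH]; [now rewrite !sum_O|].
  now rewrite Csum_S, Cplus_conj, IH, Csum_S.
Qed.

Lemma Csum_kronecker (a : nat -> C) (c : C) (l n : nat) : (l <= n)%nat ->
  sum_n (fun m => (a m * if Nat.eq_dec l m then c else RtoC 0)%C) n = (a l * c)%C.
Proof.
  induction n as [|n IH]; intros Hl.
  - replace l with 0%nat by lia. now rewrite sum_O.
  - rewrite Csum_S. destruct (Nat.eq_dec l (S n)) as [->|Hne].
    + rewrite Csum_zero; [carrier_ring|]. intros k Hk.
      destruct (Nat.eq_dec (S n) k); [lia|ring].
    + rewrite IH by lia. carrier_ring.
Qed.

(** Polynomials of degree at most M are sampled at M + 1 nodes, so there is no aliasing and the
    finite sum replaces the integral over the circle. *)
Lemma parseval (x u : nat -> C) (M : nat) :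
  sum_n (fun k => ev x M (node M k) * Cconj (ev u M (node M k)))%C M =
  (RtoC (INR (S M)) * sum_n (fun l => x l * Cconj (u l)) M)%C.
Proof.
  transitivity (sum_n (fun k => sum_n (fun l =>
    x l * (node M k ^ l * Cconj (ev u M (node M k))))%C M) M).
  { apply sum_n_ext. intros k. unfold ev at 1.
    rewrite Cmult_comm, <- Csum_scal. apply sum_n_ext. intros; carrier_ring. }
  rewrite sum_n_switch, <- Csum_scal. apply sum_n_ext_loc. intros l Hl.
  rewrite Csum_scal.
  transitivity (x l * sum_n (fun m => Cconj (u m) *
     if Nat.eq_dec l m then RtoC (INR (S M)) else RtoC 0)%C M)%C.
  2: { rewrite Csum_kronecker by exact Hl. carrier_ring. }
  f_equal.
  transitivity (sum_n (fun k => sum_n (fun m =>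
    Cconj (u m) * (node M k ^ l * Cconj (node M k) ^ m))%C M) M).
  { apply sum_n_ext. intros k. unfold ev.
    rewrite Csum_Cconj, <- Csum_scal. apply sum_n_ext. intros m.
    rewrite Cmult_conj, Cpow_conj. carrier_ring. }
  rewrite sum_n_switch. apply sum_n_ext_loc. intros m Hm.
  rewrite Csum_scal, node_orthogonal by assumption. reflexivity.
Qed.

(* Lower bound on the real part of the symbol of [D] on the unit circle,
   expressed by partial sums. *)
Definition coercive (D : nat -> C) (c : R) : Prop :=
  forall eps, 0 < eps -> exists K0, forall K z, (K0 <= K)%nat -> Cmod z = 1 ->
    c - eps <= Re (ev D K z).

Lemma Re_mult_conj (a b : C) : Re (a * b * Cconj b)%C = Re a * Cmod b ^ 2.
Proof. rewrite Cmod2_alt. destruct a, b; simpl. ring. Qed.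

(** After truncation to polynomials, Parseval turns the right-hand side into the average of Re(D)
    |u|^2 over roots of unity, where the pointwise bound applies. *)
Lemma coercive_energy (D u : nat -> C) (c : R) (N : nat) :
  coercive D c ->
  c * sum_n (fun n => Cmod (u n) ^ 2) N
  <= sum_n (fun n => Re (conv D u n * Cconj (u n))%C) N.
Proof.
  intros HD. apply le_epsilon. intros eps Heps.
  set (S2 := sum_n (fun n => Cmod (u n) ^ 2) N).
  assert (HS : 0 <= S2) by (apply Rsum_nonneg; intros; apply pow2_ge_0).
  destruct (HD (eps / (S2 + 1))) as [K0 HK0].
  { apply Rdiv_lt_0_compat; lra. }
  assert (Hd : eps / (S2 + 1) * S2 <= eps).
  { apply Rmult_le_reg_r with (S2 + 1); [lra|].
    replace (eps / (S2 + 1) * S2 * (S2 + 1)) with (eps * S2) by (field; lra). nra. }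
  set (dl := eps / (S2 + 1)) in *.
  (* Rows up to N of the convolution see only the entries of [D] up to N, so cutting [D] at K >= N
     leaves them unchanged. M bounds the degree of the product of the two truncations. *)
  set (K := Nat.max K0 N). set (M := (K + N)%nat).
  set (Q := fun n => if Nat.leb n K then D n else RtoC 0).
  set (v := fun n => if Nat.leb n N then u n else RtoC 0).
  assert (HQ : forall k, (K < k)%nat -> Q k = RtoC 0).
  { intros k Hk. unfold Q. destruct (Nat.leb_spec k K); [lia|reflexivity]. }
  assert (Hv : forall k, (N < k)%nat -> v k = RtoC 0).
  { intros k Hk. unfold v. destruct (Nat.leb_spec k N); [lia|reflexivity]. }
  assert (HQ' : forall k, (k <= K)%nat -> Q k = D k).
  { intros k Hk. unfold Q. destruct (Nat.leb_spec k K); [reflexivity|lia]. }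
  assert (Hv' : forall k, (k <= N)%nat -> v k = u k).
  { intros k Hk. unfold v. destruct (Nat.leb_spec k N); [reflexivity|lia]. }
  assert (Htr : forall g : nat -> R, (forall n, (N < n)%nat -> g n = 0) ->
             sum_n g M = sum_n g N).
  { intros g Hg. assert (HNM : (N <= M)%nat) by lia. clearbody M.
    induction HNM as [|m Hm IH]; [reflexivity|].
    rewrite Rsum_S, IH, Hg by lia. apply Rplus_0_r. }
  assert (HM : 0 < INR (S M)) by (apply lt_0_INR; lia).
  assert (P : forall x, sum_n (fun k => Re (ev x M (node M k) * Cconj (ev v M (node M k)))%C) M
      = INR (S M) * sum_n (fun n => Re (x n * Cconj (v n))%C) N).
  { intros x. rewrite <- Csum_Re, parseval.
    assert (Hre : forall (r : R) w, Re (RtoC r * w)%C = r * Re w).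
    { intros r [a b]; simpl; ring. }
    rewrite Hre, Csum_Re, Htr; [reflexivity|].
    intros n Hn. rewrite Hv by exact Hn. destruct (x n); simpl; ring. }
  assert (P1 := P (conv Q v)). assert (P2 := P v).
  assert (E1 : sum_n (fun n => Re (conv Q v n * Cconj (v n))%C) N
             = sum_n (fun n => Re (conv D u n * Cconj (u n))%C) N).
  { apply sum_n_ext_loc. intros n Hn. rewrite Hv' by exact Hn. do 2 f_equal.
    apply conv_ext; intros; [apply HQ' | apply Hv']; lia. }
  assert (Esq : forall w, Re (w * Cconj w)%C = Cmod w ^ 2).
  { intros w. rewrite Cmod2_alt. destruct w; simpl. ring. }
  assert (E2 : sum_n (fun n => Re (v n * Cconj (v n))%C) N = S2).
  { apply sum_n_ext_loc. intros n Hn. rewrite Hv' by exact Hn. apply Esq. }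
  rewrite E1 in P1. rewrite E2 in P2.
  assert (L : (c - dl) * (INR (S M) * S2)
    <= INR (S M) * sum_n (fun n => Re (conv D u n * Cconj (u n))%C) N).
  { rewrite <- P1, <- P2, <- Rsum_scal. apply Rsum_le. intros k _.
    rewrite (ev_conv Q v K N M) by (auto; lia).
    rewrite Re_mult_conj, Esq. apply Rmult_le_compat_r; [apply pow2_ge_0|].
    rewrite (ev_trunc Q K M), (ev_ext Q D) by (auto; lia).
    apply HK0; [lia|]. apply cis_Cmod. }
  assert ((c - dl) * S2 <= sum_n (fun n => Re (conv D u n * Cconj (u n))%C) N).
  { apply Rmult_le_reg_l with (INR (S M)); [exact HM|]. lra. }
  lra.
Qed.

(** Young's inequality |a b| <= (c/2) b^2 + a^2/(2c) lets half of the energy be absorbed on the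
    left. *)
Lemma coercive_l2 (D u : nat -> C) (c : R) (N : nat) :
  0 < c -> coercive D c ->
  c ^ 2 * sum_n (fun n => Cmod (u n) ^ 2) N
  <= sum_n (fun n => Cmod (conv D u n) ^ 2) N.
Proof.
  intros Hc HD. assert (H := coercive_energy D u c N HD).
  assert (H2 : sum_n (fun n => Re (conv D u n * Cconj (u n))%C) N
    <= sum_n (fun n => c / 2 * Cmod (u n) ^ 2 + / (2 * c) * Cmod (conv D u n) ^ 2) N).
  { apply Rsum_le. intros n _.
    eapply Rle_trans; [apply Rle_abs|]. eapply Rle_trans; [apply re_le_Cmod|].
    rewrite Cmod_mult, Cmod_conj.
    set (a := Cmod (conv D u n)). set (b := Cmod (u n)).
    assert (0 <= (a - c * b) ^ 2 / (2 * c)).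
    { apply Rmult_le_pos; [apply pow2_ge_0|]. apply Rlt_le, Rinv_0_lt_compat. lra. }
    replace (c / 2 * b ^ 2 + / (2 * c) * a ^ 2)
      with (a * b + (a - c * b) ^ 2 / (2 * c)) by (field; lra). lra. }
  rewrite Rsum_plus, !Rsum_scal in H2.
  assert (A : forall X Y : R, c * X <= c / 2 * X + / (2 * c) * Y -> c ^ 2 * X <= Y).
  { intros X Y H3.
    apply Rmult_le_reg_l with (/ (2 * c)); [apply Rinv_0_lt_compat; lra|].
    replace (/ (2 * c) * (c ^ 2 * X)) with (c * X - c / 2 * X) by (field; lra). lra. }
  apply A. eapply Rle_trans; [exact H | exact H2].
Qed.

Lemma coercive_rotate (D : nat -> C) (c : R) (e : C) :
  Cmod e = 1 -> coercive D c -> coercive (fun k => D k * e ^ k)%C c.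
Proof.
  intros He HD eps Heps. destruct (HD eps Heps) as [K0 HK]. exists K0.
  intros K z HK0 Hz.
  replace (ev (fun k => D k * e ^ k)%C K z) with (ev D K (e * z)%C).
  - apply HK; [exact HK0|]. rewrite Cmod_mult, He, Hz. ring.
  - apply sum_n_ext. intros k. rewrite Cpow_mult_l. carrier_ring.
Qed.

(** * Power-law decay and inverses *)

Lemma Rpower_pos (x y : R) : 0 < Rpower x y.
Proof. apply exp_pos. Qed.

Lemma ln_le_minus_1 (x : R) : 0 < x -> ln x <= x - 1.
Proof.
  intros Hx. assert (H := exp_ineq1_le (ln x)). rewrite exp_ln in H by exact Hx. lra.
Qed.

Definition wt (a : R) (n : nat) : R := Rpower (INR (S n)) (- (1 + a)).

Lemma wt_pos (a : R) (n : nat) : 0 < wt a n.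
Proof. apply Rpower_pos. Qed.

(** Discrete form of comparing the sum with the integral of x^(-1-a). It rests on ln x <= ln (x + 1)
    - 1/(x + 1) and exp v >= 1 + v. *)
Lemma wt_telescope (a : R) (n : nat) : 0 < a ->
  a * wt a (S n) <= Rpower (INR (S n)) (- a) - Rpower (INR (S (S n))) (- a).
Proof.
  intros Ha. unfold wt. rewrite (S_INR (S n)).
  assert (Hx : 0 < INR (S n)) by (apply lt_0_INR; lia).
  set (x := INR (S n)) in *.
  replace (- (1 + a)) with (- a + - (1)) by ring.
  rewrite Rpower_plus, Rpower_Ropp, Rpower_Ropp, Rpower_1 by lra.
  rewrite <- !Rpower_Ropp.
  assert (Hl : ln x <= ln (x + 1) - / (x + 1)).
  { replace (ln x) with (ln (x / (x + 1)) + ln (x + 1)).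
    - assert (H := ln_le_minus_1 (x / (x + 1))).
      replace (x / (x + 1) - 1) with (- / (x + 1)) in H by (field; lra).
      specialize (H ltac:(apply Rdiv_lt_0_compat; lra)). lra.
    - rewrite <- ln_mult; [f_equal; field; lra| apply Rdiv_lt_0_compat; lra | lra]. }
  assert (H : Rpower (x + 1) (- a) * (1 + a * / (x + 1)) <= Rpower x (- a)).
  { unfold Rpower.
    apply Rle_trans with (exp (- a * ln (x + 1)) * exp (a * / (x + 1))).
    - apply Rmult_le_compat_l; [apply Rlt_le, exp_pos | apply exp_ineq1_le].
    - rewrite <- exp_plus.
      assert (Hm : - a * ln (x + 1) + a * / (x + 1) <= - a * ln x) by nra.
      destruct Hm as [Hm|Hm]; [apply Rlt_le, exp_increasing, Hm | rewrite Hm; lra]. }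
  lra.
Qed.

Lemma wt_sum (a : R) (N : nat) : 0 < a -> sum_n (wt a) N <= 1 + / a.
Proof.
  intros Ha.
  assert (H : sum_n (wt a) N <= 1 + / a * (1 - Rpower (INR (S N)) (- a))).
  { induction N as [|N IH].
    - rewrite sum_O. unfold wt. simpl INR. unfold Rpower.
      rewrite ln_1, !Rmult_0_r, exp_0. lra.
    - rewrite Rsum_S. assert (T := wt_telescope a N Ha).
      apply (Rmult_le_compat_l (/ a)) in T; [|apply Rlt_le, Rinv_0_lt_compat, Ha].
      rewrite <- Rmult_assoc, Rinv_l, Rmult_1_l in T by lra. lra. }
  assert (P := Rpower_pos (INR (S N)) (- a)).
  assert (Hi := Rinv_0_lt_compat a Ha). nra.
Qed.

Definition decay (a K : R) (D : nat -> C) : Prop := forall n, Cmod (D n) <= K * wt a n.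

Lemma decay_nonneg (a K : R) (D : nat -> C) : decay a K D -> 0 <= K.
Proof.
  intros H. specialize (H 0%nat). assert (P := wt_pos a 0).
  assert (Q := Cmod_ge_0 (D 0%nat)). nra.
Qed.

Lemma decay_sum (a K : R) (D : nat -> C) (N : nat) : 0 < a -> decay a K D ->
  sum_n (fun n => Cmod (D n)) N <= K * (1 + / a).
Proof.
  intros Ha H. eapply Rle_trans.
  - apply Rsum_le. intros k _. apply H.
  - rewrite Rsum_scal. apply Rmult_le_compat_l; [eapply decay_nonneg, H | apply wt_sum, Ha].
Qed.

Lemma decay_plus (a K K' : R) (D D' : nat -> C) :
  decay a K D -> decay a K' D' -> decay a (K + K') (fun n => D n + D' n)%C.
Proof.
  intros H H' n. eapply Rle_trans; [apply Cmod_triangle|].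
  specialize (H n). specialize (H' n). lra.
Qed.

Lemma decay_scal (a K : R) (c : C) (D : nat -> C) :
  decay a K D -> decay a (Cmod c * K) (fun n => c * D n)%C.
Proof.
  intros H n. rewrite Cmod_mult, Rmult_assoc.
  apply Rmult_le_compat_l; [apply Cmod_ge_0 | apply H].
Qed.

Lemma Rpower_antitone (x y b : R) : 0 < x <= y -> 0 <= b -> Rpower y (- b) <= Rpower x (- b).
Proof.
  intros [Hx Hxy] Hb. rewrite !Rpower_Ropp.
  apply Rinv_le_contravar; [apply Rpower_pos|]. apply Rle_Rpower_l; lra.
Qed.

Lemma wt_comparable (a : R) (i l : nat) : 0 < a ->
  INR (S l) <= 2 * INR (S i) -> wt a i <= Rpower 2 (1 + a) * wt a l.
Proof.
  intros Ha H. unfold wt.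
  assert (Hi : 0 < INR (S i)) by (apply lt_0_INR; lia).
  assert (Hl : 0 < INR (S l)) by (apply lt_0_INR; lia).
  replace (Rpower 2 (1 + a) * Rpower (INR (S l)) (- (1 + a)))
    with (Rpower (INR (S l) / 2) (- (1 + a))).
  - apply Rpower_antitone; lra.
  - unfold Rdiv. rewrite <- Rpower_mult_distr by lra.
    rewrite (Rmult_comm (Rpower (INR (S l)) _)). f_equal.
    unfold Rpower. f_equal. rewrite ln_Rinv by lra. ring.
Qed.

(** The larger of j and k is at least half of j + k, so its weight is at most 2^(1+a) times that of
    j + k. This makes [decay] stable under convolution. *)
Lemma wt_mult (a : R) (j k : nat) : 0 < a ->
  wt a j * wt a k <= Rpower 2 (1 + a) * wt a (j + k) * (wt a j + wt a k).
Proof.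
  intros Ha. assert (A := fun i l => wt_comparable a i l Ha).
  assert (Pj := wt_pos a j). assert (Pk := wt_pos a k). assert (Pn := wt_pos a (j + k)).
  assert (P2 := Rpower_pos 2 (1 + a)).
  destruct (Nat.le_ge_cases j k) as [H|H].
  - assert (B := A k (j + k)%nat). rewrite !S_INR, plus_INR in B.
    apply le_INR in H. specialize (B ltac:(lra)).
    assert (0 <= Rpower 2 (1 + a) * wt a (j + k)) by nra. nra.
  - assert (B := A j (j + k)%nat). rewrite !S_INR, plus_INR in B.
    apply le_INR in H. specialize (B ltac:(lra)).
    assert (0 <= Rpower 2 (1 + a) * wt a (j + k)) by nra. nra.
Qed.

Lemma Rsum_shift (g : nat -> R) (n : nat) :
  sum_n g (S n) = g 0%nat + sum_n (fun k => g (S k)) n.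
Proof.
  induction n as [|n IH].
  - now rewrite Rsum_S, !sum_O.
  - rewrite Rsum_S, IH, Rsum_S. apply Rplus_assoc.
Qed.

Lemma Rsum_rev (g : nat -> R) (n : nat) : sum_n (fun j => g (n - j)%nat) n = sum_n g n.
Proof.
  induction n as [|n IH]; [now rewrite !sum_O|].
  rewrite Rsum_shift, Rsum_S. simpl (S n - _)%nat.
  rewrite <- IH. apply Rplus_comm.
Qed.

Lemma decay_conv (a K K' : R) (x y : nat -> C) : 0 < a ->
  decay a K x -> decay a K' y ->
  decay a (K * K' * Rpower 2 (1 + a) * (2 * (1 + / a))) (conv x y).
Proof.
  intros Ha Hx Hy n.
  assert (HK := decay_nonneg _ _ _ Hx). assert (HK' := decay_nonneg _ _ _ Hy).
  assert (P2 := Rpower_pos 2 (1 + a)). assert (Pn := wt_pos a n).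
  assert (HKK : 0 <= K * K') by (apply Rmult_le_pos; assumption).
  assert (HC : 0 <= K * K' * (Rpower 2 (1 + a) * wt a n)).
  { apply Rmult_le_pos; [exact HKK|]. apply Rmult_le_pos; lra. }
  eapply Rle_trans; [apply conv_Cmod|].
  apply Rle_trans with (sum_n (fun j => K * K' * (Rpower 2 (1 + a) * wt a n)
      * (wt a j + wt a (n - j)%nat)) n).
  - apply Rsum_le. intros j Hj.
    assert (W := wt_mult a j (n - j) Ha). replace (j + (n - j))%nat with n in W by lia.
    apply Rle_trans with ((K * wt a j) * (K' * wt a (n - j)%nat)).
    + apply Rmult_le_compat; try apply Cmod_ge_0; [apply Hx | apply Hy].
    + apply (Rmult_le_compat_l (K * K')) in W; [lra|exact HKK].
  - rewrite Rsum_scal, Rsum_plus, (Rsum_rev (wt a)).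
    assert (S := wt_sum a n Ha).
    apply Rle_trans with (K * K' * (Rpower 2 (1 + a) * wt a n) * (2 * (1 + / a))).
    + apply Rmult_le_compat_l; [exact HC | lra].
    + right. ring.
Qed.

(** * Rotation differences and summability of the inverse *)

Lemma chord_sq (t : R) : Cmod (1 - cis t)%C ^ 2 = 2 - 2 * cos t.
Proof.
  rewrite Cmod2_alt. simpl. assert (H := sin2_cos2 t). unfold Rsqr in H. nra.
Qed.

Lemma one_minus_cos_le (t : R) : 0 < t -> 2 - 2 * cos t <= t ^ 2.
Proof.
  intros Ht.
  assert (Hc : cos t = 1 - 2 * sin (t / 2) * sin (t / 2)).
  { rewrite <- cos_2a_sin. f_equal. field. }
  assert (H1 : sin (t / 2) < t / 2) by (apply sin_lt_x; lra).
  assert (H2 : - (t / 2) < sin (t / 2)).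
  { destruct (Rlt_le_dec (t / 2) PI) as [H|H].
    - assert (0 < sin (t / 2)) by (apply sin_gt_0; lra). lra.
    - assert (B := SIN_bound (t / 2)). assert (P := PI2_3_2). lra. }
  nra.
Qed.

(** The squared chord is at most both u^2 and 4; the power 1 + a, lying between 1 and 2,
    interpolates between these bounds. *)
Lemma chord_le_power (a u : R) : 0 <= a <= 1 -> 0 < u -> 2 - 2 * cos u <= 4 * Rpower u (1 + a).
Proof.
  intros Ha Hu. destruct (Rle_lt_dec u 1) as [H|H].
  - assert (H1 := one_minus_cos_le u Hu).
    assert (u ^ 2 <= Rpower u (1 + a)).
    { rewrite <- Rpower_pow by exact Hu. unfold Rpower. simpl INR.
      assert (ln u <= 0) by (rewrite <- ln_1; apply ln_le; lra).
      assert (Hm : (1 + 1) * ln u <= (1 + a) * ln u) by nra.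
      destruct Hm as [Hm|Hm]; [apply Rlt_le, exp_increasing, Hm | rewrite Hm; lra]. }
    assert (P := Rpower_pos u (1 + a)). lra.
  - assert (1 <= Rpower u (1 + a)).
    { assert (P : Rpower u 0 <= Rpower u (1 + a)) by (apply Rle_Rpower; lra).
      now rewrite Rpower_O in P by lra. }
    assert (B := COS_bound u). lra.
Qed.

(** The exponent 1 + a in the chord bound cancels exactly one of the two weight factors in |D_n|^2;
    the remaining one is summable. *)
Lemma decay_rotation_l2 (a K h : R) (D : nat -> C) (N : nat) :
  0 < a <= 1 -> 0 < h -> decay a K D ->
  sum_n (fun n => (Cmod (D n) * Cmod (1 - cis h ^ n)%C) ^ 2) N
  <= 4 * K ^ 2 * Rpower h (1 + a) * (1 + / a).
Proof.
  intros Ha Hh HD.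
  apply Rle_trans with (sum_n (fun n => 4 * K ^ 2 * Rpower h (1 + a) * wt a n) N).
  - apply Rsum_le. intros n _.
    rewrite Rpow_mult_distr, cis_pow, chord_sq.
    assert (Hn : 0 < INR (S n)) by (apply lt_0_INR; lia).
    assert (E : 2 - 2 * cos (INR n * h) <= 4 * Rpower (INR (S n) * h) (1 + a)).
    { destruct n as [|n].
      - simpl INR. rewrite Rmult_0_l, cos_0.
        assert (P := Rpower_pos (1 * h) (1 + a)). lra.
      - assert (Hn' : 0 < INR (S n)) by (apply lt_0_INR; lia).
        eapply Rle_trans; [apply (chord_le_power a); [lra | nra]|].
        apply Rmult_le_compat_l; [lra|]. apply Rle_Rpower_l; [lra|].
        rewrite (S_INR (S n)). nra. }
    rewrite <- Rpower_mult_distr in E by assumption.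
    specialize (HD n). assert (P := Cmod_ge_0 (D n)).
    assert (HD2 : Cmod (D n) ^ 2 <= K ^ 2 * wt a n ^ 2).
    { rewrite <- Rpow_mult_distr. apply pow_incr. lra. }
    assert (B := COS_bound (INR n * h)).
    assert (W : wt a n * Rpower (INR (S n)) (1 + a) = 1).
    { unfold wt. rewrite Rpower_Ropp. apply Rinv_l, Rgt_not_eq, Rpower_pos. }
    apply Rle_trans with (K ^ 2 * wt a n ^ 2
        * (4 * (Rpower (INR (S n)) (1 + a) * Rpower h (1 + a)))).
    + apply Rmult_le_compat; [apply pow2_ge_0 | lra | exact HD2 | exact E].
    + right.
      replace (K ^ 2 * wt a n ^ 2 * (4 * (Rpower (INR (S n)) (1 + a) * Rpower h (1 + a))))
        with (4 * K ^ 2 * Rpower h (1 + a) * wt a n * (wt a n * Rpower (INR (S n)) (1 + a)))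
        by ring.
      rewrite W. ring.
  - rewrite Rsum_scal. apply Rmult_le_compat_l; [|apply wt_sum; lra].
    assert (P := Rpower_pos h (1 + a)). assert (0 <= K ^ 2) by apply pow2_ge_0. nra.
Qed.

(** Let D' and e' be the rotated sequences and y = D' - D. The resolvent identity says that D
    convolved with e - e' is y convolved with e', and D' convolved with the latter is y. Coercivity
    of D and of D' each contributes a factor c^2. *)
Lemma inverse_rotation_l2 (D e : nat -> C) (c h : R) (N : nat) :
  0 < c -> coercive D c -> (forall n, conv D e n = delta0 n) ->
  c ^ 4 * sum_n (fun n => (Cmod (e n) * Cmod (1 - cis h ^ n)%C) ^ 2) N
  <= sum_n (fun n => (Cmod (D n) * Cmod (1 - cis h ^ n)%C) ^ 2) N.
Proof.
  intros Hc HD He. set (eta := cis h).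
  set (D' := fun n => (D n * eta ^ n)%C). set (e' := fun n => (e n * eta ^ n)%C).
  assert (He' : forall n, conv D' e' n = delta0 n).
  { intros n. unfold D', e'. rewrite conv_rotate, He. destruct n; simpl; ring. }
  assert (HD' : coercive D' c) by (apply coercive_rotate; [apply cis_Cmod | exact HD]).
  set (y := fun n => (D' n + (-1) * D n)%C).
  set (x := fun n => (e n + (-1) * e' n)%C).
  assert (Hx : forall n, conv D x n = conv y e' n).
  { intros n. unfold x, y. rewrite conv_comm, !conv_plus_l, !conv_scal_l, He'.
    rewrite (conv_comm e D), He, (conv_comm e' D). reflexivity. }
  assert (Hy : forall n, conv D' (conv y e') n = y n).
  { intros n. rewrite (conv_ext D' D' (conv y e') (conv e' y)) by (auto using conv_comm).
    rewrite <- conv_assoc, (conv_ext _ delta0 y y) by (auto using conv_comm).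
    apply conv_delta_l. }
  assert (E1 := coercive_l2 D x c N Hc HD).
  rewrite (sum_n_ext (fun n => Cmod (conv D x n) ^ 2)
    (fun n => Cmod (conv y e' n) ^ 2)) in E1
    by (intros n; now rewrite Hx).
  assert (E2 := coercive_l2 D' (conv y e') c N Hc HD').
  rewrite (sum_n_ext (fun n => Cmod (conv D' _ n) ^ 2) (fun n => Cmod (y n) ^ 2)) in E2
    by (intros n; now rewrite Hy).
  rewrite (sum_n_ext _ (fun n => Cmod (x n) ^ 2)).
  2: { intros n. unfold x, e'. rewrite <- Cmod_mult. do 2 f_equal. ring. }
  rewrite (sum_n_ext (fun n => (Cmod (D n) * _) ^ 2) (fun n => Cmod (y n) ^ 2)).
  2: { intros n. unfold y, D'. rewrite <- Cmod_mult, <- Cmod_opp. do 2 f_equal. ring. }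
  apply (Rmult_le_compat_l (c ^ 2)) in E1; [|apply pow2_ge_0].
  eapply Rle_trans; [|exact E2]. eapply Rle_trans; [|exact E1].
  right. unfold Rpower. rewrite <- Rmult_assoc. f_equal. ring.
Qed.

(** Additive substitute for Cauchy-Schwarz on a block: it is used with y_n >= x_n^2 / t on the
    block, and the free parameter t is tuned to the block length. *)
Lemma block_bound (x y : nat -> R) (t : R) (N m : nat) :
  (forall n, 0 <= y n) ->
  (forall n, (N < n <= N + m)%nat -> x n <= t + y n) ->
  sum_n x (N + m) <= sum_n x N + INR m * t + sum_n y (N + m).
Proof.
  intros Hy. induction m as [|m IH]; intros H.
  - rewrite Nat.add_0_r. simpl INR.
    assert (0 <= sum_n y N) by (apply Rsum_nonneg; auto). lra.
  - rewrite Nat.add_succ_r, !Rsum_S, S_INR.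
    assert (H1 := IH ltac:(intros; apply H; lia)).
    assert (H2 := H (S (N + m)) ltac:(lia)). lra.
Qed.

(* Bernstein's criterion: the rotation differences of the inverse are controlled
   in l^2 by those of [D], and a rotation of angle [1 / N] detects the
   coefficients with index between [N] and [2 N]. *)
Theorem inverse_summable (D e : nat -> C) (a K c : R) :
  0 < a <= 1 -> 0 < c -> decay a K D -> coercive D c ->
  (forall n, conv D e n = delta0 n) ->
  exists E, forall N, sum_n (fun n => Cmod (e n)) N <= E.
Proof.
  intros Ha Hc HD HDc He.
  set (s := (fun N => sum_n (fun n => Cmod (e n)) N) : nat -> R).
  (* Squared chord of angle 1. For N < n <= 2N and h = 1/N the angle n h lies in [1, 2], inside
     [0, pi], so its squared chord is at least [c1]. *)
  set (c1 := 2 - 2 * cos 1).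
  assert (Hc1 : 0 < c1).
  { unfold c1. assert (cos 1 < cos 0).
    { apply cos_decreasing_1; assert (P := PI2_3_2); lra. }
    rewrite cos_0 in H. lra. }
  set (C0 := 4 * K ^ 2 * (1 + / a) / c ^ 4 / c1).
  assert (HC0 : 0 <= C0).
  { unfold C0. assert (Hi := Rinv_0_lt_compat a (proj1 Ha)).
    assert (H4 : 0 < c ^ 4) by (apply pow_lt, Hc).
    apply Rmult_le_pos; [apply Rmult_le_pos|]; try (apply Rlt_le, Rinv_0_lt_compat; assumption).
    assert (0 <= K ^ 2) by apply pow2_ge_0. nra. }
  assert (Hblock : forall N, (1 <= N)%nat ->
    s (N + N)%nat <= s N + (1 + C0) * Rpower (INR N) (- (a / 2))).
  { intros N HN. apply le_INR in HN. simpl INR in HN.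
    (* This t balances the two contributions: both N t and h^(1+a) / t equal N^(-a/2). *)
    set (t := Rpower (INR N) (- (1 + a / 2))).
    assert (Ht : 0 < t) by apply Rpower_pos.
    set (h := / INR N). assert (Hh : 0 < h) by (apply Rinv_0_lt_compat; lra).
    set (y := fun n => / (c1 * t) * (Cmod (e n) * Cmod (1 - cis h ^ n)%C) ^ 2).
    assert (Hct : 0 < c1 * t) by (apply Rmult_lt_0_compat; lra).
    assert (B := block_bound (fun n => Cmod (e n)) y t N N).
    eapply Rle_trans; [apply B|].
    - intros n. apply Rmult_le_pos; [|apply pow2_ge_0].
      apply Rlt_le, Rinv_0_lt_compat, Hct.
    - intros n [Hn1 Hn2]. apply lt_INR in Hn1. apply le_INR in Hn2. rewrite plus_INR in Hn2.
      unfold y. rewrite Rpow_mult_distr, cis_pow, chord_sq.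
      assert (L : c1 <= 2 - 2 * cos (INR n * h)).
      { unfold c1. assert (cos (INR n * h) <= cos 1); [|lra].
        assert (P := PI2_3_2).
        assert (1 <= INR n * h <= 2).
        { unfold h. split; apply Rmult_le_reg_r with (INR N); try lra;
            rewrite Rmult_assoc, Rinv_l; lra. }
        apply cos_decr_1; lra. }
      set (z := Cmod (e n)).
      assert (Z : c1 * z ^ 2 <= z ^ 2 * (2 - 2 * cos (INR n * h))).
      { assert (0 <= z ^ 2) by apply pow2_ge_0. nra. }
      apply Rle_trans with (t + / (c1 * t) * (c1 * z ^ 2)).
      + replace (/ (c1 * t) * (c1 * z ^ 2)) with (/ t * z ^ 2) by (field; lra).
        apply Rmult_le_reg_l with t; [exact Ht|].
        replace (t * (t + / t * z ^ 2)) with (t ^ 2 + z ^ 2) by (field; lra).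
        assert (0 <= (t - z / 2) ^ 2) by apply pow2_ge_0.
        assert (0 <= z ^ 2) by apply pow2_ge_0. nra.
      + apply Rplus_le_compat_l, Rmult_le_compat_l; [|exact Z].
        apply Rlt_le, Rinv_0_lt_compat, Hct.
    - assert (I := inverse_rotation_l2 D e c h (N + N) Hc HDc He).
      assert (J := decay_rotation_l2 a K h D (N + N) Ha Hh HD).
      unfold y. rewrite Rsum_scal.
      assert (Q : INR N * t = Rpower (INR N) (- (a / 2))).
      { unfold t. rewrite <- (Rpower_1 (INR N)) at 1 by lra.
        rewrite <- Rpower_plus. f_equal. field. }
      rewrite Q.
      assert (V : Rpower h (1 + a) = t * Rpower (INR N) (- (a / 2))).
      { unfold t, h. rewrite <- Rpower_plus. unfold Rpower. f_equal.
        rewrite ln_Rinv by lra. field. }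
      rewrite V in J.
      set (X := sum_n (fun n => (Cmod (e n) * Cmod (1 - cis h ^ n)%C) ^ 2) (N + N)) in *.
      assert (H4 : 0 < c ^ 4) by (apply pow_lt, Hc).
      assert (Y : / (c1 * t) * X <= C0 * Rpower (INR N) (- (a / 2))).
      { apply Rmult_le_reg_l with (c ^ 4 * (c1 * t)); [apply Rmult_lt_0_compat; assumption|].
        apply Rle_trans with (4 * K ^ 2 * (t * Rpower (INR N) (- (a / 2))) * (1 + / a)).
        - eapply Rle_trans; [|exact J]. eapply Rle_trans; [|exact I].
          right. rewrite Rmult_assoc. f_equal. rewrite <- Rmult_assoc, Rinv_r by lra.
          apply Rmult_1_l.
        - right. unfold C0. field. lra. }
      set (P := Rpower (INR N) (- (a / 2))) in *.
      apply Rle_trans with (s N + P + C0 * P); [apply Rplus_le_compat_l, Y | right; ring]. }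
  (* The block after 2^k contributes at most (1 + C0) q^k, so the dyadic partial sums are dominated
     by a geometric series. *)
  set (q := Rpower 2 (- (a / 2))).
  assert (Hq : 0 < q < 1).
  { split; [apply Rpower_pos|].
    assert (P : q < Rpower 2 0) by (apply Rpower_lt; lra).
    now rewrite Rpower_O in P by lra. }
  assert (Hdy : forall k, s (2 ^ k)%nat <= s 1%nat + (1 + C0) / (1 - q) * (1 - q ^ k)).
  { induction k as [|k IH].
    - simpl. lra.
    - replace (2 ^ S k)%nat with (2 ^ k + 2 ^ k)%nat by (simpl; lia).
      eapply Rle_trans; [apply Hblock|].
      { clear. induction k; simpl; lia. }
      replace (Rpower (INR (2 ^ k)) (- (a / 2))) with (q ^ k).
      + simpl (q ^ S k).
        replace ((1 + C0) / (1 - q) * (1 - q * q ^ k))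
          with ((1 + C0) / (1 - q) * (1 - q ^ k) + (1 + C0) * q ^ k) by (field; lra).
        lra.
      + rewrite <- Rpower_pow by apply Hq. unfold q.
        rewrite Rpower_mult, pow_INR, <- Rpower_pow by (simpl; lra).
        rewrite Rpower_mult. replace (INR 2) with 2 by (simpl; ring). f_equal. ring. }
  exists (s 1%nat + (1 + C0) / (1 - q)). intros N.
  apply Rle_trans with (s (2 ^ N)%nat).
  - apply (Rsum_incr (fun n => Cmod (e n))); [intros; apply Cmod_ge_0|].
    apply Nat.lt_le_incl, Nat.pow_gt_lin_r. lia.
  - eapply Rle_trans; [apply Hdy|].
    assert (0 <= (1 + C0) / (1 - q)).
    { apply Rmult_le_pos; [lra|]. apply Rlt_le, Rinv_0_lt_compat. lra. }
    assert (0 < q ^ N) by (apply pow_lt, Hq). nra.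
Qed.

(** * Power series and passage from the disc to the circle *)

Lemma pow_n_Cpow (z : C) (n : nat) : pow_n (K := C_AbsRing) z n = (z ^ n)%C.
Proof.
  induction n as [|n IH]; [reflexivity|]. simpl. rewrite IH. reflexivity.
Qed.

Lemma is_pseries_ev (D : nat -> C) (z v : C) :
  is_pseries (K := C_AbsRing) (V := C_NormedModule) D z v <->
  forall eps, 0 < eps -> exists N, forall n, (N <= n)%nat -> Cmod (ev D n z - v)%C < eps.
Proof.
  assert (E : forall n, sum_n (fun k => scal (pow_n (K := C_AbsRing) z k) (D k)) n
              = ev D n z).
  { intros n. apply sum_n_ext. intros k. rewrite pow_n_Cpow. apply Cmult_comm. }
  unfold is_pseries, is_series. split.
  - intros H eps Heps.
    assert (H' := proj1 (filterlim_locally_ball_norm _ _) H (mkposreal eps Heps)).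
    destruct H' as [N HN]. exists N. intros n Hn. specialize (HN n Hn).
    rewrite E in HN. exact HN.
  - intros H. apply filterlim_locally_ball_norm. intros eps.
    destruct (H eps (cond_pos eps)) as [N HN]. exists N. intros n Hn.
    rewrite E. exact (HN n Hn).
Qed.

Lemma ev_increment (D : nat -> C) (z : C) (N M : nat) : Cmod z <= 1 -> (N <= M)%nat ->
  Cmod (ev D M z - ev D N z)%C
  <= sum_n (fun n => Cmod (D n)) M - sum_n (fun n => Cmod (D n)) N.
Proof.
  intros Hz H. induction H as [|M H IH].
  - replace (ev D N z - ev D N z)%C with (RtoC 0) by ring. rewrite Cmod_0. lra.
  - rewrite Rsum_S. unfold ev in *. rewrite Csum_S.
    set (A := sum_n (fun l => (D l * z ^ l)%C) M) in *.
    set (B := sum_n (fun l => (D l * z ^ l)%C) N) in *.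
    replace (A + D (S M) * z ^ S M - B)%C with ((A - B) + D (S M) * z ^ S M)%C by carrier_ring.
    eapply Rle_trans; [apply Cmod_triangle|].
    rewrite Cmod_mult, Cmod_pow.
    assert (0 <= Cmod z ^ S M <= 1).
    { split; [apply pow_le, Cmod_ge_0|]. rewrite <- (pow1 (S M)).
      apply pow_incr. split; [apply Cmod_ge_0 | exact Hz]. }
    assert (P := Cmod_ge_0 (D (S M))). nra.
Qed.

Lemma summable_tail (s : nat -> R) (B : R) :
  (forall n, 0 <= s n) -> (forall N, sum_n s N <= B) ->
  forall eps, 0 < eps -> exists N, forall n m, (N <= n)%nat -> (n <= m)%nat ->
    sum_n s m - sum_n s n <= eps.
Proof.
  intros Hs HB eps Heps.
  destruct (ex_finite_lim_seq_incr (sum_n s) B) as [l Hl].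
  { intros n. rewrite Rsum_S. specialize (Hs (S n)). lra. }
  { exact HB. }
  assert (Hle : forall n, sum_n s n <= l).
  { apply is_lim_seq_incr_compare; [exact Hl|].
    intros n. rewrite Rsum_S. specialize (Hs (S n)). lra. }
  apply is_lim_seq_spec in Hl. destruct (Hl (mkposreal eps Heps)) as [N HN].
  exists N. intros n m Hn Hm. specialize (HN N (Nat.le_refl N)). simpl in HN.
  apply Rabs_def2 in HN. specialize (Hle m).
  assert (sum_n s N <= sum_n s n) by (apply Rsum_incr; assumption). lra.
Qed.

Lemma one_minus_pow_le (r : R) (k : nat) : 0 <= r <= 1 -> 0 <= 1 - r ^ k <= INR k * (1 - r).
Proof.
  intros Hr. induction k as [|k IH].
  - simpl. lra.
  - rewrite S_INR. simpl.
    assert (0 <= r ^ k) by (apply pow_le; lra). nra.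
Qed.

(** The hypothesis lives inside the disc, coercivity on the circle. A partial sum is moved inward to
    a radius that may depend on its length K; there it is compared with [F] through the tail of the
    absolute series, which is small uniformly in the radius. *)
Lemma coercive_of_series (D : nat -> C) (F : C -> C) (B c : R) :
  (forall N, sum_n (fun n => Cmod (D n)) N <= B) ->
  (forall z, Cmod z < 1 -> is_pseries (K := C_AbsRing) (V := C_NormedModule) D z (F z)) ->
  (forall z, Cmod z < 1 -> c <= Re (F z)) ->
  coercive D c.
Proof.
  intros HB HF Hc eps Heps.
  destruct (summable_tail (fun n => Cmod (D n)) B (fun n => Cmod_ge_0 _) HB (eps / 4))
    as [K0 HK0]; [lra|].
  exists K0. intros K z HK Hz.
  assert (HB0 : 0 <= B).
  { eapply Rle_trans; [|apply (HB 0%nat)]. rewrite sum_O. apply Cmod_ge_0. }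
  assert (HK' := pos_INR K).
  set (Q := INR K * B). assert (HQ : 0 <= Q) by (apply Rmult_le_pos; assumption).
  (* Moving z inward by [dl] changes the partial sum by at most dl K B = dl Q; the other half of eps
     pays for the tail. *)
  set (dl := Rmin (1 / 2) (eps / (2 * (Q + 1)))).
  assert (Hdl : 0 < dl <= 1 / 2).
  { split; [apply Rmin_pos; [lra | apply Rdiv_lt_0_compat; lra] | apply Rmin_l]. }
  assert (HdQ : dl * Q <= eps / 2).
  { apply Rle_trans with (eps / (2 * (Q + 1)) * Q).
    - apply Rmult_le_compat_r; [exact HQ | apply Rmin_r].
    - apply Rmult_le_reg_r with (2 * (Q + 1)); [lra|].
      replace (eps / (2 * (Q + 1)) * Q * (2 * (Q + 1))) with (eps * Q) by (field; lra).
      nra. }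
  set (r := 1 - dl). set (w := (RtoC r * z)%C).
  assert (Hw : Cmod w = r).
  { unfold w. rewrite Cmod_mult, Hz, Cmod_R, Rabs_pos_eq; unfold r; lra. }
  assert (Hw1 : Cmod w < 1) by (rewrite Hw; unfold r; lra).
  assert (T1 : Cmod (ev D K z - ev D K w)%C <= dl * Q).
  { unfold ev. replace (sum_n (fun l => (D l * z ^ l)%C) K
        - sum_n (fun l => (D l * w ^ l)%C) K)%C
      with (sum_n (fun l => (D l * z ^ l + (-1) * (D l * w ^ l))%C) K).
    2: { rewrite Csum_plus, (Csum_scal (-1)). carrier_ring. }
    eapply Rle_trans; [apply Csum_Cmod|].
    apply Rle_trans with (sum_n (fun l => INR K * dl * Cmod (D l)) K).
    - apply Rsum_le. intros l Hl.
      replace (D l * z ^ l + (-1) * (D l * w ^ l))%C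
        with (D l * (z ^ l * RtoC (1 - r ^ l)))%C.
      2: { unfold w. rewrite Cpow_mult_l, RtoC_minus, RtoC_pow. ring. }
      rewrite !Cmod_mult, Cmod_pow, Hz, pow1, Rmult_1_l, Cmod_R.
      destruct (one_minus_pow_le r l) as [G1 G2]; [unfold r; lra|].
      rewrite Rabs_pos_eq by exact G1.
      assert (P := Cmod_ge_0 (D l)). apply le_INR in Hl.
      replace (1 - r) with dl in G2 by (unfold r; ring).
      assert (1 - r ^ l <= INR K * dl) by nra. nra.
    - rewrite Rsum_scal. specialize (HB K). unfold Q.
      assert (0 <= INR K * dl) by nra. nra. }
  assert (T2 : Cmod (ev D K w - F w)%C <= eps / 2).
  { specialize (HF w Hw1). apply is_pseries_ev with (eps := eps / 4) in HF; [|lra].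
    destruct HF as [N HN]. set (M := Nat.max N K).
    specialize (HN M ltac:(lia)). specialize (HK0 K M HK ltac:(lia)).
    assert (I := ev_increment D w K M ltac:(lra) ltac:(lia)).
    replace (ev D K w - F w)%C with ((ev D M w - F w) + - (ev D M w - ev D K w))%C by ring.
    eapply Rle_trans; [apply Cmod_triangle|]. rewrite Cmod_opp. lra. }
  specialize (Hc w Hw1).
  assert (R1 := re_le_Cmod (ev D K z - ev D K w)%C).
  assert (R2 := re_le_Cmod (ev D K w - F w)%C).
  assert (Hre : forall u v, Re (u - v)%C = Re u - Re v) by (intros [? ?] [? ?]; reflexivity).
  rewrite Hre in R1, R2. apply Rabs_le_between in R1. apply Rabs_le_between in R2. lra.
Qed.

(** * The branch of the power *)

Lemma continuous_Im_ray (L : C -> C) (z : C) (t : R) :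
  ex_derive (K := C_AbsRing) (V := C_NormedModule) L (RtoC t * z)%C ->
  continuity_pt (fun t => Im (L (RtoC t * z)%C)) t.
Proof.
  intros H. apply ex_derive_continuous in H.
  intros eps Heps.
  destruct (proj1 (filterlim_locally _ _) H (mkposreal eps Heps)) as [d Hd].
  assert (HZ := Cmod_ge_0 z).
  exists (d / (Cmod z + 1)). split.
  { apply Rdiv_lt_0_compat; [apply cond_pos | lra]. }
  intros t' [_ Ht']. unfold dist in *; simpl in *. unfold R_dist in *.
  assert (Hb : Cmod (RtoC t' * z - RtoC t * z)%C < d).
  { replace (RtoC t' * z - RtoC t * z)%C with (RtoC (t' - t) * z)%C
      by (rewrite RtoC_minus; ring).
    rewrite Cmod_mult, Cmod_R. assert (P := cond_pos d).
    assert (P' := Rabs_pos (t' - t)).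
    apply Rle_lt_trans with (d / (Cmod z + 1) * Cmod z).
    - apply Rmult_le_compat_r; [exact HZ | lra].
    - apply Rmult_lt_reg_r with (Cmod z + 1); [lra|].
      replace (d / (Cmod z + 1) * Cmod z * (Cmod z + 1)) with (d * Cmod z) by (field; lra).
      nra. }
  destruct (Hd (RtoC t' * z)%C Hb) as [_ H2]. exact H2.
Qed.

(** Reaching pi/2 or -pi/2 would, by the intermediate value theorem, make the cosine vanish on the
    way. *)
Lemma cos_pos_path (g : R -> R) :
  g 0 = 0 -> (forall t, 0 <= t <= 1 -> continuity_pt g t) ->
  (forall t, 0 <= t <= 1 -> 0 < cos (g t)) -> - (PI / 2) < g 1 < PI / 2.
Proof.
  intros H0 Hg Hc. assert (HP := PI2_RGT_0).
  assert (A : forall f, f 0 = 0 -> (forall t, 0 <= t <= 1 -> continuity_pt f t) ->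
    (forall t, 0 <= t <= 1 -> 0 < cos (f t)) -> f 1 < PI / 2).
  { clear. intros f H0 Hf Hc. assert (HP := PI2_RGT_0).
    destruct (Rlt_le_dec (f 1) (PI / 2)) as [H|H]; [exact H|].
    destruct H as [H|H].
    - destruct (Ranalysis5.IVT_interv (fun t => f t - PI / 2) 0 1) as [t [Ht E]]; try lra.
      + intros t Ht. apply continuity_pt_minus; [apply Hf, Ht|].
        apply continuity_pt_const. intros ? ?; reflexivity.
      + specialize (Hc t Ht). replace (f t) with (PI / 2) in Hc by lra.
        rewrite cos_PI2 in Hc. lra.
    - specialize (Hc 1 ltac:(lra)). rewrite <- H, cos_PI2 in Hc. lra. }
  split; [|now apply A].
  assert (- g 1 < PI / 2); [|lra].
  apply (A (fun t => - g t)); [lra| |].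
  - intros t Ht. now apply continuity_pt_opp, Hg.
  - intros t Ht. rewrite cos_neg. now apply Hc.
Qed.

Definition polar (s t : R) : C := (s * cos t, s * sin t).

(** The logarithm [L] is known only up to a multiple of 2 pi i. Since b(0) > 0, t0 = Im L(0) is such
    a multiple, and positivity of G(0) makes alpha t0 one too, so subtracting t0 changes neither b
    nor G. Continuity along the ray from 0 to z, on which Re b > 0, then keeps the corrected
    argument in (-pi/2, pi/2). *)
Lemma is_power_branch_polar (b : C -> C) (alpha : R) (G : C -> C) (z : C) :
  is_power_branch b alpha G ->
  (forall w, Cmod w < 1 -> 0 < Re (b w)) -> Im (b (RtoC 0)) = 0 ->
  Cmod z < 1 ->
  exists s t, 0 < s /\ - (PI / 2) < t < PI / 2 /\
    b z = polar s t /\ G z = polar (Rpower s alpha) (alpha * t).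
Proof.
  intros [[L HL] [r [Hr HG0]]] Hb Hb0 Hz.
  set (t0 := Im (L (RtoC 0))).
  assert (H0 : Cmod (RtoC 0) < 1) by (rewrite Cmod_0; lra).
  destruct (HL _ H0) as (_ & E0 & F0).
  assert (Hcs : cos t0 = 1 /\ sin t0 = 0).
  { specialize (Hb _ H0). rewrite <- E0 in Hb, Hb0. unfold Cexp in Hb, Hb0; simpl in Hb, Hb0.
    fold t0 in Hb, Hb0. assert (P := exp_pos (Re (L (RtoC 0)))).
    assert (S : sin t0 = 0) by nra. split; [|exact S].
    assert (Q := sin2_cos2 t0). unfold Rsqr in Q. rewrite S in Q. nra. }
  assert (Hcs' : cos (alpha * t0) = 1 /\ sin (alpha * t0) = 0).
  { rewrite HG0 in F0. unfold Cexp in F0.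
    assert (F1 := f_equal Re F0). assert (F2 := f_equal Im F0). simpl in F1, F2.
    rewrite !Rmult_0_l, ?Rplus_0_r, ?Rminus_0_r in F1, F2.
    change (snd (L (RtoC 0))) with t0 in F1, F2.
    set (E := exp (alpha * fst (L (RtoC 0)))) in *.
    assert (P : 0 < E) by apply exp_pos.
    assert (S : sin (alpha * t0) = 0) by (apply Rmult_eq_reg_l with E; lra). split; [|exact S].
    assert (Q := sin2_cos2 (alpha * t0)). unfold Rsqr in Q. rewrite S in Q.
    assert (0 < cos (alpha * t0)) by nra. nra. }
  destruct (HL z Hz) as (_ & E & F).
  assert (Hray : forall t, 0 <= t <= 1 -> Cmod (RtoC t * z)%C < 1).
  { intros t Ht. rewrite Cmod_mult, Cmod_R, Rabs_pos_eq by lra.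
    assert (P := Cmod_ge_0 z). nra. }
  assert (Hsh : forall u, cos (u - t0) = cos u /\ sin (u - t0) = sin u).
  { intros u.
    rewrite cos_minus, sin_minus. destruct Hcs as [H1 H2]. rewrite H1, H2. split; ring. }
  exists (exp (Re (L z))), (Im (L z) - t0).
  split; [apply exp_pos|]. split; [|split].
  - assert (P := cos_pos_path (fun t => Im (L (RtoC t * z)%C) - t0)).
    cbv beta in P. rewrite Cmult_1_l in P. apply P.
    + rewrite Cmult_0_l. unfold t0. ring.
    + intros t Ht. apply continuity_pt_minus.
      * apply continuous_Im_ray. apply (HL _ (Hray t Ht)).
      * apply continuity_pt_const. intros ? ?; reflexivity.
    + intros t Ht. rewrite (proj1 (Hsh _)).
      assert (Q := Hb _ (Hray t Ht)). rewrite <- (proj1 (proj2 (HL _ (Hray t Ht)))) in Q.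
      unfold Cexp in Q; simpl in Q.
      assert (X := exp_pos (Re (L (RtoC t * z)%C))). nra.
  - rewrite <- E. unfold polar. destruct (Hsh (Im (L z))) as [-> ->]. reflexivity.
  - rewrite F. unfold polar, Cexp, Rpower. rewrite ln_exp.
    replace (alpha * (Im (L z) - t0)) with (alpha * Im (L z) - alpha * t0) by ring.
    rewrite cos_minus, sin_minus. destruct Hcs' as [-> ->].
    simpl. unfold Re, Im.
    replace (alpha * fst (L z) - 0 * snd (L z)) with (alpha * fst (L z)) by ring.
    replace (alpha * snd (L z) + 0 * fst (L z)) with (alpha * snd (L z)) by ring.
    f_equal; ring.
Qed.

Lemma is_power_branch_real (b : C -> C) (alpha : R) (G : C -> C) (x y : R) :
  is_power_branch b alpha G ->
  (forall w, Cmod w < 1 -> 0 < Re (b w)) -> Im (b (RtoC 0)) = 0 ->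
  Rabs x < 1 -> b (RtoC x) = RtoC y -> G (RtoC x) = RtoC (Rpower y alpha).
Proof.
  intros HG Hb Hb0 Hx Hy.
  destruct (is_power_branch_polar b alpha G (RtoC x) HG Hb Hb0) as (s & t & Hs & Ht & E & F).
  { now rewrite Cmod_R. }
  rewrite Hy in E. unfold polar, RtoC in E. injection E as E1 E2.
  assert (Ht0 : t = 0).
  { assert (P := PI_RGT_0). destruct (Rtotal_order t 0) as [H|[H|H]]; [|exact H|].
    - assert (0 < sin (- t)) by (apply sin_gt_0; lra). rewrite sin_neg in *. nra.
    - assert (0 < sin t) by (apply sin_gt_0; lra). nra. }
  subst t. rewrite F, E1. unfold polar, RtoC.
  rewrite Rmult_0_r, cos_0, sin_0, !Rmult_1_r, Rmult_0_r. reflexivity.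
Qed.

(** * Sector bounds for the generating functions *)

Lemma unit_disc_shift (z : C) : Cmod z < 1 -> Cmod (1 - z)%C ^ 2 < 2 * Re (1 - z)%C.
Proof.
  intros Hz. assert (H : Cmod z ^ 2 < 1).
  { assert (P := Cmod_ge_0 z). nra. }
  rewrite Cmod2_alt in *. destruct z as [a b]; simpl in *. nra.
Qed.

Lemma unit_disc_shift_Re (z : C) : Cmod z < 1 -> 0 < Re (1 - z)%C.
Proof.
  intros Hz. assert (H := unit_disc_shift z Hz).
  assert (P := pow2_ge_0 (Cmod (1 - z)%C)). lra.
Qed.

Lemma bdf_base_1 (z : C) : bdf_base 1 z = (1 - z)%C.
Proof.
  unfold bdf_base. rewrite sum_n_n. simpl INR. rewrite Rinv_1, Cpow_1_r. apply Cmult_1_l.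
Qed.

Lemma bdf_base_2 (z : C) : bdf_base 2 z = ((1 - z) * (1 + RtoC (/ 2) * (1 - z)))%C.
Proof.
  unfold bdf_base. rewrite sum_n_Sm, sum_n_n by lia.
  simpl INR. rewrite Rinv_1. change (1 + 1)%R with 2.
  change (RtoC 1 * (1 - z) ^ 1 + RtoC (/ 2) * (1 - z) ^ 2
    = (1 - z) * (1 + RtoC (/ 2) * (1 - z)))%C.
  simpl Cpow. ring.
Qed.

(** With 1 - z = u + i v the real part is u + (u^2 - v^2)/2, and v^2 < 2u - u^2 makes it larger than
    u^2. *)
Lemma bdf_base_2_Re (z : C) : Cmod z < 1 -> 0 < Re (bdf_base 2 z).
Proof.
  intros Hz. rewrite bdf_base_2. assert (H := unit_disc_shift z Hz).
  rewrite Cmod2_alt in H. destruct z as [a b]; simpl in *. nra.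
Qed.

(** An exponent in (0, 1] shrinks the argument towards 0 and keeps its sign. *)
Lemma power_sector (b : C -> C) (alpha : R) (G : C -> C) (z : C) :
  0 < alpha <= 1 -> is_power_branch b alpha G ->
  (forall w, Cmod w < 1 -> 0 < Re (b w)) -> Im (b (RtoC 0)) = 0 ->
  Cmod z < 1 ->
  0 <= Re (G z) /\ 0 <= Im (G z) * Im (b z).
Proof.
  intros Ha HG Hb Hb0 Hz.
  destruct (is_power_branch_polar b alpha G z HG Hb Hb0 Hz) as (s & t & Hs & Ht & E & F).
  assert (P := Rpower_pos s alpha). assert (HP := PI2_RGT_0).
  rewrite E, F. unfold polar; simpl. split.
  - apply Rmult_le_pos; [lra|]. apply cos_ge_0; nra.
  - assert (0 <= sin (alpha * t) * sin t).
    { destruct (Rle_lt_dec 0 t) as [H|H].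
      - apply Rmult_le_pos; apply sin_ge_0; nra.
      - replace (sin (alpha * t) * sin t) with (sin (alpha * - t) * sin (- t)).
        + apply Rmult_le_pos; apply sin_ge_0; nra.
        + replace (alpha * - t) with (- (alpha * t)) by ring. rewrite !sin_neg. ring. }
    replace (Rpower s alpha * sin (alpha * t) * (s * sin t))
      with (Rpower s alpha * s * (sin (alpha * t) * sin t)) by ring.
    apply Rmult_le_pos; [|assumption]. apply Rmult_le_pos; lra.
Qed.

(** This is the real part of y^a (1 + (a/2) y) divided by s^a, where y has modulus s and argument t.
    The term containing cos ((1 + a) t) can be negative, but what is subtracted is at most s/2 < cos
    t <= cos (a t). *)
Lemma newton_gregory_angle (a s t : R) :
  0 < a <= 1 -> 0 < s -> - (PI / 2) < t < PI / 2 -> s < 2 * cos t ->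
  0 <= cos (a * t) + a / 2 * s * (cos (a * t) * cos t - sin (a * t) * sin t).
Proof.
  intros Ha Hs. revert t.
  assert (A : forall t, 0 <= t < PI / 2 -> s < 2 * cos t ->
    0 <= cos (a * t) + a / 2 * s * (cos (a * t) * cos t - sin (a * t) * sin t)).
  { intros t Ht Hst.
    assert (C1 : cos t <= cos (a * t)) by (apply cos_decr_1; nra).
    assert (S1 : 0 <= sin (a * t)) by (apply sin_ge_0; nra).
    assert (S2 : sin (a * t) <= sin t) by (apply sin_incr_1; nra).
    assert (Q := sin2_cos2 t). unfold Rsqr in Q.
    set (c := cos t) in *. set (d := sin t) in *.
    set (c' := cos (a * t)) in *. set (d' := sin (a * t)) in *.
    assert (X : a / 2 * s * (d' * d) <= c).
    { assert (0 <= d' * d <= 1) by nra.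
      apply Rle_trans with (1 / 2 * s * 1); [|lra].
      apply Rmult_le_compat; nra. }
    assert (0 <= a / 2 * s * (c' * c)).
    { apply Rmult_le_pos; [nra|]. nra. }
    lra. }
  intros t Ht Hst. destruct (Rle_lt_dec 0 t) as [H|H]; [apply A; lra|].
  assert (B := A (- t)). replace (a * - t) with (- (a * t)) in B by ring.
  rewrite !cos_neg, !sin_neg in B.
  replace (- sin (a * t) * - sin t) with (sin (a * t) * sin t) in B by ring.
  apply B; lra.
Qed.

(** The second inequality is the half-plane condition for omega / (1 - z), multiplied by |1 - z|^2.
    It follows when omega and 1 - z have imaginary parts of the same sign, apart from the
    second-order Newton-Gregory factor. *)
Lemma generating_function_sector (fam : gen_family) (p : nat) (alpha : R)
    (omega : C -> C) (z : C) :
  0 < alpha <= 1 -> (p = 1%nat \/ p = 2%nat) ->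
  is_generating_function fam p alpha omega -> Cmod z < 1 ->
  0 <= Re (omega z) /\ 0 <= Re (omega z * Cconj (1 - z))%C.
Proof.
  intros Ha Hp Hg Hz. assert (HR := unit_disc_shift_Re z Hz).
  assert (Hconj : forall u v, Re (u * Cconj v)%C = Re u * Re v + Im u * Im v).
  { intros [? ?] [? ?]; simpl; ring. }
  assert (Hb1 : forall w, Cmod w < 1 -> 0 < Re (bdf_base 1 w)).
  { intros w Hw. rewrite bdf_base_1. apply unit_disc_shift_Re, Hw. }
  destruct fam.
  - destruct Hp as [-> | ->]; simpl in Hg.
    + destruct (power_sector _ _ _ z Ha Hg Hb1) as [H1 H2]; [|exact Hz|].
      { rewrite bdf_base_1. simpl. ring. }
      rewrite bdf_base_1 in H2. split; [exact H1|]. rewrite Hconj. nra.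
    + destruct (power_sector _ _ _ z Ha Hg bdf_base_2_Re) as [H1 H2]; [|exact Hz|].
      { rewrite bdf_base_2. simpl. ring. }
      rewrite bdf_base_2 in H2. split; [exact H1|]. rewrite Hconj.
      set (y := (1 - z)%C) in *.
      (* As 1 + Re y > 0, the base of order 2 has an imaginary part of the same sign as that of
         y. *)
      replace (Im (y * (1 + RtoC (/ 2) * y))%C) with (Im y * (1 + Re y)) in H2.
      2: { destruct y as [u v]; simpl; field. }
      assert (0 <= Im (omega z) * Im y).
      { apply Rmult_le_reg_r with (1 + Re y); [lra|]. lra. }
      nra.
  - destruct Hg as (G & HG & Hom). rewrite (Hom z Hz).
    set (b := fun w : C => (1 - w)%C).
    assert (Hb : forall w, Cmod w < 1 -> 0 < Re (b w)) by exact unit_disc_shift_Re.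
    assert (Hb0 : Im (b (RtoC 0)) = 0) by (simpl; ring).
    destruct (power_sector b _ _ z Ha HG Hb Hb0 Hz) as [H1 H2].
    assert (H3 : 0 <= Re (G z * Cconj (b z))%C) by (rewrite Hconj; specialize (Hb z Hz); nra).
    destruct Hp as [-> | ->]; simpl ng_factor.
    + rewrite Cmult_1_r. split; [exact H1|exact H3].
    + split.
      * destruct (is_power_branch_polar b alpha G z HG Hb Hb0 Hz)
          as (s & t & Hs & Ht & E & F).
        assert (Hst := unit_disc_shift z Hz). fold (b z) in *. rewrite E, F in *.
        rewrite Cmod2_alt in Hst. unfold polar in *. simpl in Hst |- *.
        assert (Q := sin2_cos2 t). unfold Rsqr in Q.
        assert (s < 2 * cos t).
        { apply Rmult_lt_reg_l with s; [exact Hs|].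
          replace (s * s) with (s * cos t * (s * cos t * 1) + s * sin t * (s * sin t * 1)).
          - lra.
          - transitivity (s * s * (sin t * sin t + cos t * cos t)); [ring|].
            rewrite Q. ring. }
        assert (A := newton_gregory_angle alpha s t Ha Hs Ht H).
        assert (P := Rpower_pos s alpha).
        match goal with |- 0 <= ?x => replace x with (Rpower s alpha *
          (cos (alpha * t) + alpha / 2 * s * (cos (alpha * t) * cos t - sin (alpha * t) * sin t)))
          by ring end.
        apply Rmult_le_pos; lra.
      * fold (b z). set (y := b z) in *.
        replace (Re (G z * (1 + RtoC (alpha / 2) * y) * Cconj y)%C)
          with (Re (G z * Cconj y)%C + alpha / 2 * (Re (G z) * Cmod y ^ 2)).
        -- assert (P := pow2_ge_0 (Cmod y)).
           assert (0 <= Re (G z) * Cmod y ^ 2) by (apply Rmult_le_pos; assumption). nra.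
        -- rewrite Cmod2_alt. destruct (G z), y; simpl. ring.
Qed.

(** Values on (-1, 1), which already determine the Taylor coefficients. The default case stands for
    order 1 of both families. *)
Definition real_symbol (fam : gen_family) (p : nat) (alpha x : R) : R :=
  match fam, p with
  | FractionalBDF, 2%nat => Rpower ((1 - x) * (1 + / 2 * (1 - x))) alpha
  | NewtonGregory, 2%nat => Rpower (1 - x) alpha * (1 + alpha / 2 * (1 - x))
  | _, _ => Rpower (1 - x) alpha
  end.

Lemma generating_function_real (fam : gen_family) (p : nat) (alpha : R)
    (omega : C -> C) (x : R) :
  (p = 1%nat \/ p = 2%nat) ->
  is_generating_function fam p alpha omega -> Rabs x < 1 ->
  omega (RtoC x) = RtoC (real_symbol fam p alpha x).
Proof.
  intros Hp Hg Hx. destruct fam.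
  - destruct Hp as [-> | ->]; simpl in Hg; unfold real_symbol.
    + apply (is_power_branch_real (bdf_base 1)); trivial.
      * intros w Hw. rewrite bdf_base_1. apply unit_disc_shift_Re, Hw.
      * rewrite bdf_base_1. simpl. ring.
      * now rewrite bdf_base_1, RtoC_minus.
    + apply (is_power_branch_real (bdf_base 2)); trivial.
      * apply bdf_base_2_Re.
      * rewrite bdf_base_2. simpl. ring.
      * rewrite bdf_base_2, RtoC_mult, RtoC_plus, RtoC_mult, RtoC_minus. reflexivity.
  - destruct Hg as (G & HG & Hom). rewrite Hom by (now rewrite Cmod_R).
    rewrite (is_power_branch_real (fun w => 1 - w)%C alpha G x (1 - x)); trivial.
    + destruct Hp as [-> | ->]; simpl.
      * now rewrite Cmult_1_r.
      * rewrite RtoC_mult, RtoC_plus, RtoC_mult, RtoC_minus. reflexivity.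
    + intros w Hw. apply unit_disc_shift_Re, Hw.
    + simpl. ring.
    + now rewrite RtoC_minus.
Qed.

(** * Binomial series *)

(* Coefficients of [(1 - x) ^ (a - 1)], which are also the partial sums of
   those of [(1 - x) ^ a]. *)
Fixpoint bsum (a : R) (n : nat) : R :=
  match n with
  | O => 1
  | S k => bsum a k * (1 - a / INR (S k))
  end.

Definition bcoef (a : R) (n : nat) : R :=
  match n with
  | O => 1
  | S k => - a / INR (S k) * bsum a k
  end.

Lemma bcoef_sum (a : R) (n : nat) : sum_n (bcoef a) n = bsum a n.
Proof.
  induction n as [|n IH]; [now rewrite sum_O|].
  rewrite Rsum_S, IH. simpl bcoef. simpl bsum. unfold Rdiv. carrier_ring.
Qed.

(** Induction with 1 - a/x <= exp (-a/x) and ln (x + 1) - ln x <= 1/x at x = n + 1. *)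
Lemma bsum_bounds (a : R) (n : nat) : 0 < a <= 1 ->
  0 <= bsum a n <= Rpower (INR (S n)) (- a).
Proof.
  intros Ha. induction n as [|n [IH1 IH2]].
  - simpl. unfold Rpower. rewrite ln_1, Rmult_0_r, exp_0. lra.
  - change (bsum a (S n)) with (bsum a n * (1 - a / INR (S n))).
    rewrite (S_INR (S n)).
    assert (Hx : 1 <= INR (S n)) by (apply (le_INR 1); lia).
    set (x := INR (S n)) in *.
    assert (Hi : 0 < / x <= 1).
    { split; [apply Rinv_0_lt_compat; lra|]. rewrite <- Rinv_1.
      apply Rinv_le_contravar; lra. }
    assert (Hax : a / x <= 1) by (unfold Rdiv; nra).
    split; [apply Rmult_le_pos; lra|].
    apply Rle_trans with (Rpower x (- a) * exp (- (a / x))).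
    + apply Rmult_le_compat; try lra. apply exp_ineq1_le.
    + unfold Rpower. rewrite <- exp_plus.
      assert (Hl : ln (x + 1) - ln x <= / x).
      { replace (x + 1) with (x * (1 + / x)) by (field; lra).
        rewrite ln_mult by lra. assert (H := ln_le_minus_1 (1 + / x)).
        specialize (H ltac:(lra)). lra. }
      assert (Hm : - a * ln x + - (a / x) <= - a * ln (x + 1)) by (unfold Rdiv; nra).
      destruct Hm as [Hm|Hm]; [apply Rlt_le, exp_increasing, Hm | rewrite Hm; lra].
Qed.

Lemma bsum_lim (a : R) : 0 < a <= 1 -> is_lim_seq (bsum a) 0.
Proof.
  intros Ha. apply is_lim_seq_spec. intros eps.
  destruct (nfloor_ex (Rpower (/ eps) (/ a))) as [N HN].
  { apply Rlt_le, Rpower_pos. }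
  exists N. intros n Hn. destruct (bsum_bounds a n Ha) as [H1 H2].
  rewrite Rminus_0_r, Rabs_pos_eq by exact H1.
  eapply Rle_lt_trans; [exact H2|].
  assert (He := cond_pos eps).
  assert (Hlt : Rpower (/ eps) (/ a) < INR (S n)).
  { apply le_INR in Hn. rewrite S_INR. lra. }
  assert (Hlt' : / eps < Rpower (INR (S n)) a).
  { replace (/ eps) with (Rpower (Rpower (/ eps) (/ a)) a).
    - apply Rlt_Rpower_l; [lra|]. split; [apply Rpower_pos | exact Hlt].
    - rewrite Rpower_mult, Rinv_l by lra. apply Rpower_1, Rinv_0_lt_compat, He. }
  rewrite Rpower_Ropp, <- (Rinv_inv eps).
  apply Rinv_lt_contravar; [|exact Hlt'].
  apply Rmult_lt_0_compat; [apply Rinv_0_lt_compat, He | apply Rpower_pos].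
Qed.

(** The coefficient of index n + 1 is bounded by [wt a n]; the factor 2^(1+a) pays for the shift of
    the index. *)
Lemma bcoef_decay (a : R) : 0 < a <= 1 ->
  decay a (Rpower 2 (1 + a)) (fun n => RtoC (bcoef a n)).
Proof.
  intros Ha n. rewrite Cmod_R.
  destruct n as [|n].
  - simpl bcoef. rewrite Rabs_R1.
    assert (H := wt_comparable a 0 0 (proj1 Ha)). simpl INR in H.
    specialize (H ltac:(lra)).
    assert (E : wt a 0 = 1).
    { unfold wt, Rpower. simpl INR. now rewrite ln_1, Rmult_0_r, exp_0. }
    rewrite E in *. lra.
  - apply Rle_trans with (wt a n).
    + destruct (bsum_bounds a n Ha) as [H1 H2].
      change (bcoef a (S n)) with (- a / INR (S n) * bsum a n).
      assert (Hx : 1 <= INR (S n)) by (apply (le_INR 1); lia).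
      assert (Hi := Rinv_0_lt_compat (INR (S n)) ltac:(lra)).
      rewrite Rabs_mult, (Rabs_pos_eq (bsum a n)) by exact H1.
      unfold Rdiv. rewrite Ropp_mult_distr_l_reverse, Rabs_Ropp, Rabs_pos_eq
        by (apply Rmult_le_pos; lra).
      unfold wt. replace (- (1 + a)) with (- (1) + - a) by ring.
      rewrite Rpower_plus, (Rpower_Ropp _ 1), Rpower_1 by lra.
      apply Rmult_le_compat; try assumption; [apply Rmult_le_pos; lra | nra].
    + apply wt_comparable; [lra|]. rewrite (S_INR (S n)), S_INR.
      assert (P := pos_INR n). lra.
Qed.

Lemma bounded_inside_radius (c : nat -> R) (M x : R) :
  (forall n, Rabs (c n) <= M) -> Rabs x < 1 -> Rbar_lt (Rabs x) (CV_radius c).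
Proof.
  intros Hc Hx. apply Rbar_lt_le_trans with (y := Finite 1); [exact Hx|].
  apply (CV_radius_bounded c). exists M. intros n. now rewrite pow1, Rmult_1_r.
Qed.

Lemma bsum_bounded (a : R) (n : nat) : 0 < a <= 1 -> Rabs (bsum a n) <= 1.
Proof.
  intros Ha. destruct (bsum_bounds a n Ha) as [H1 H2].
  rewrite Rabs_pos_eq by exact H1. eapply Rle_trans; [exact H2|].
  assert (Hx : 1 <= INR (S n)) by (apply (le_INR 1); lia).
  assert (P := Rpower_antitone 1 (INR (S n)) a ltac:(lra) ltac:(lra)).
  eapply Rle_trans; [exact P|]. unfold Rpower. rewrite ln_1, Rmult_0_r, exp_0. lra.
Qed.

Lemma bcoef_bounded (a : R) (n : nat) : 0 < a <= 1 -> Rabs (bcoef a n) <= 2.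
Proof.
  intros Ha. destruct n as [|n]; [simpl; rewrite Rabs_R1; lra|].
  replace (bcoef a (S n)) with (bsum a (S n) - bsum a n).
  - assert (H1 := bsum_bounded a n Ha). assert (H2 := bsum_bounded a (S n) Ha).
    apply Rabs_le_between in H1. apply Rabs_le_between in H2. apply Rabs_le. lra.
  - simpl. unfold Rdiv. ring.
Qed.

(** The series f satisfies (1 - t) f' = -a f: both sides are expressed through the series of [bsum].
    Hence f(t) (1 - t)^(-a) has zero derivative, and it equals 1 at t = 0. *)
Lemma PSeries_bcoef (a x : R) : 0 < a <= 1 -> Rabs x < 1 ->
  PSeries (bcoef a) x = Rpower (1 - x) a.
Proof.
  intros Ha.
  assert (Rs : forall t, Rabs t < 1 -> Rbar_lt (Rabs t) (CV_radius (bsum a))).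
  { intros t Ht. apply (bounded_inside_radius _ 1); [|exact Ht].
    intros n. apply bsum_bounded, Ha. }
  assert (Rc : forall t, Rabs t < 1 -> Rbar_lt (Rabs t) (CV_radius (bcoef a))).
  { intros t Ht. apply (bounded_inside_radius _ 2); [|exact Ht].
    intros n. apply bcoef_bounded, Ha. }
  assert (E1 : forall t, Rabs t < 1 -> PSeries (bcoef a) t = (1 - t) * PSeries (bsum a) t).
  { intros t Ht.
    rewrite (PSeries_ext (bcoef a) (PS_plus (bsum a) (PS_scal (-1) (PS_incr_1 (bsum a))))).
    - rewrite PSeries_plus, PSeries_scal, PSeries_incr_1.
      + ring.
      + apply CV_radius_inside, Rs, Ht.
      + apply CV_radius_inside. rewrite CV_radius_scal, CV_radius_incr_1 by lra.
        apply Rs, Ht.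
    - intros [|n]; unfold PS_plus, PS_scal, PS_incr_1, plus, scal, zero; simpl;
        unfold mult; simpl; unfold Rdiv; ring. }
  assert (E2 : forall t, PSeries (PS_derive (bcoef a)) t = - a * PSeries (bsum a) t).
  { intros t. rewrite <- PSeries_scal. apply PSeries_ext. intros n.
    unfold PS_derive.
    change (INR (S n) * (- a / INR (S n) * bsum a n) = - a * bsum a n).
    field. apply not_0_INR. lia. }
  set (h := fun t => PSeries (bcoef a) t * exp (- a * ln (1 - t))).
  assert (Hd : forall t, Rabs t < 1 -> is_derive h t 0).
  { intros t Ht. assert (Ht' := Rabs_def2 _ _ Ht).
    evar_last.
    - apply (is_derive_mult (PSeries (bcoef a)) (fun t => exp (- a * ln (1 - t)))).
      + apply is_derive_PSeries, Rc, Ht.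
      + instantiate (1 := a * / (1 - t) * exp (- a * ln (1 - t))).
        auto_derive; [lra|]. unfold Rminus.
        match goal with |- @eq _ ?u ?v => change (@eq R u v) end. field. lra.
      + intros; apply Rmult_comm.
    - rewrite E1, E2 by exact Ht. unfold plus, mult; simpl. field. lra. }
  intros Hx. assert (Hx' := Rabs_def2 _ _ Hx).
  assert (Hh : h x = h 0).
  { destruct (Rtotal_order x 0) as [H|[H|H]].
    - apply (eq_is_derive h x 0); [|exact H]. intros t Ht. apply Hd, Rabs_def1; lra.
    - now rewrite H.
    - symmetry. apply (eq_is_derive h 0 x); [|exact H].
      intros t Ht. apply Hd, Rabs_def1; lra. }
  unfold h in Hh. rewrite PSeries_0 in Hh. simpl bcoef in Hh.
  rewrite Rminus_0_r, ln_1, Rmult_0_r, exp_0, Rmult_1_r in Hh.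
  unfold Rpower. apply Rmult_eq_reg_r with (exp (- a * ln (1 - x))).
  - rewrite Hh, <- exp_plus.
    replace (a * ln (1 - x) + - a * ln (1 - x)) with 0 by ring. now rewrite exp_0.
  - apply Rgt_not_eq, exp_pos.
Qed.

(** * Taylor coefficients of the generating functions *)

Lemma ev_real (w : nat -> C) (x : R) (n : nat) :
  Re (ev w n (RtoC x)) = sum_n (fun k => Re (w k) * x ^ k) n /\
  Im (ev w n (RtoC x)) = sum_n (fun k => Im (w k) * x ^ k) n.
Proof.
  unfold ev. rewrite Csum_Re, Csum_Im. split; apply sum_n_ext; intros k;
    rewrite <- RtoC_pow; destruct (w k); simpl; ring.
Qed.

Lemma is_pseries_real (w : nat -> C) (x : R) (v : C) :
  is_pseries (K := C_AbsRing) (V := C_NormedModule) w (RtoC x) v ->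
  is_pseries (fun n => Re (w n)) x (Re v) /\ is_pseries (fun n => Im (w n)) x (Im v).
Proof.
  intros H. rewrite is_pseries_ev in H.
  assert (A : forall n, Rabs (Re (ev w n (RtoC x)) - Re v) <= Cmod (ev w n (RtoC x) - v)%C
                 /\ Rabs (Im (ev w n (RtoC x)) - Im v) <= Cmod (ev w n (RtoC x) - v)%C).
  { intros n. set (u := ev w n (RtoC x)).
    assert (M := Rmax_Cmod (u - v)%C). split; eapply Rle_trans; [|exact M| |exact M].
    - apply (Rmax_l (Rabs (Re u - Re v))).
    - apply (Rmax_r _ (Rabs (Im u - Im v))). }
  assert (B : forall (c : nat -> R) l,
    (forall eps : posreal, eventually (fun n => Rabs (sum_n (fun k => c k * x ^ k) n - l) < eps))
     -> is_pseries c x l).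
  { intros c l Hc.
    apply (is_lim_seq_spec (sum_n (fun k => c k * x ^ k)) (Finite l)) in Hc.
    unfold is_pseries, is_series.
    eapply filterlim_ext; [|exact Hc]. intros n. apply sum_n_ext. intros k.
    apply Rmult_comm. }
  split; apply B; intros eps; destruct (H eps (cond_pos eps)) as [N HN]; exists N;
    intros n Hn; specialize (HN n Hn); destruct (A n) as [A1 A2];
    destruct (ev_real w x n) as [E1 E2]; [rewrite <- E1 | rewrite <- E2]; lra.
Qed.

Lemma pseries_radius_pos (c : nat -> R) (l : R) :
  is_pseries c (1 / 2) l -> Rbar_lt 0 (CV_radius c).
Proof.
  intros H. destruct (Rbar_lt_dec 0 (CV_radius c)) as [H0|H0]; [exact H0|exfalso].
  apply (CV_disk_outside c (1 / 2)).
  - eapply Rbar_le_lt_trans; [apply Rbar_not_lt_le, H0|].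
    simpl. rewrite Rabs_pos_eq; lra.
  - assert (E : ex_series (fun n => c n * (1 / 2) ^ n)).
    { exists l. eapply is_series_ext; [|exact H]. intros n.
      apply Rmult_comm. }
    exact (ex_series_lim_0 _ E).
Qed.

(** On the real axis the complex series splits into two real ones, for Re w and Im w, and uniqueness
    of real power series applies to each. *)
Lemma taylor_coefficients_real (omega : C -> C) (w : nat -> C) (c : nat -> R) (M : R) :
  are_taylor_coefficients omega w -> (forall n, Rabs (c n) <= M) ->
  (forall x, Rabs x < 1 -> omega (RtoC x) = RtoC (PSeries c x)) ->
  forall n, w n = RtoC (c n).
Proof.
  intros Hw Hc Hom n.
  assert (A : forall x, Rabs x < 1 -> is_pseries (fun n => Re (w n)) x (PSeries c x)
      /\ is_pseries (fun n => Im (w n)) x 0).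
  { intros x Hx. specialize (Hw (RtoC x)). rewrite Cmod_R, Hom in Hw by exact Hx.
    apply (is_pseries_real w x (RtoC (PSeries c x))), Hw, Hx. }
  assert (Hh : Rabs (1 / 2) < 1) by (rewrite Rabs_pos_eq; lra).
  destruct (A _ Hh) as [H1 H2].
  assert (Rc : Rbar_lt 0 (CV_radius c)).
  { rewrite <- Rabs_R0. apply (bounded_inside_radius c M); [exact Hc|]. rewrite Rabs_R0. lra. }
  assert (L : locally 0 (fun x : R => Rabs x < 1)).
  { exists (mkposreal 1 Rlt_0_1). intros y Hy. unfold ball in Hy; simpl in Hy.
    unfold AbsRing_ball, abs, minus, plus, opp in Hy; simpl in Hy.
    now rewrite Ropp_0, Rplus_0_r in Hy. }
  assert (E1 : Re (w n) = c n).
  { apply (PSeries_ext_recip (fun n => Re (w n)) c n); [exact (pseries_radius_pos _ _ H1)|exact Rc|].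
    apply filter_imp with (2 := L). intros x Hx. apply is_pseries_unique, (A x Hx). }
  assert (E2 : Im (w n) = 0).
  { apply (PSeries_ext_recip (fun n => Im (w n)) (fun _ => 0) n);
      [exact (pseries_radius_pos _ _ H2)| |].
    - now rewrite CV_radius_const_0.
    - apply filter_imp with (2 := L). intros x Hx.
      rewrite (is_pseries_unique _ _ _ (proj2 (A x Hx))). symmetry. apply PSeries_const_0. }
  unfold RtoC. rewrite <- E1, <- E2. destruct (w n); reflexivity.
Qed.

Lemma wt_le_1 (a : R) (n : nat) : 0 < a -> wt a n <= 1.
Proof.
  intros Ha. assert (Hx : 1 <= INR (S n)) by (apply (le_INR 1); lia).
  assert (P := Rpower_antitone 1 (INR (S n)) (1 + a) ltac:(lra) ltac:(lra)).
  eapply Rle_trans; [exact P|]. unfold Rpower. rewrite ln_1, Rmult_0_r, exp_0. lra.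
Qed.

Lemma decay_bounded (a K : R) (D : nat -> C) (n : nat) : 0 < a -> decay a K D ->
  Cmod (D n) <= K.
Proof.
  intros Ha H. assert (HK := decay_nonneg _ _ _ H). assert (W := wt_le_1 a n Ha).
  specialize (H n). nra.
Qed.

Lemma Rsum_term_le (s : nat -> R) (n N : nat) :
  (forall k, 0 <= s k) -> (n <= N)%nat -> s n <= sum_n s N.
Proof.
  intros Hs H. eapply Rle_trans; [|apply (Rsum_incr s n N Hs H)].
  destruct n as [|n]; [rewrite sum_O; lra|]. rewrite Rsum_S.
  assert (0 <= sum_n s n) by (apply Rsum_nonneg; auto). lra.
Qed.

Lemma decay_finite (a : R) (D : nat -> C) (N : nat) :
  (forall n, (N < n)%nat -> D n = RtoC 0) -> exists K, decay a K D.
Proof.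
  intros H. set (s := fun n => Cmod (D n) / wt a n).
  assert (Hs : forall n, 0 <= s n).
  { intros n. apply Rmult_le_pos; [apply Cmod_ge_0|].
    apply Rlt_le, Rinv_0_lt_compat, wt_pos. }
  exists (sum_n s N). intros n. assert (W := wt_pos a n).
  destruct (Nat.le_gt_cases n N) as [Hn|Hn].
  - apply Rle_trans with (s n * wt a n).
    + right. unfold s. field. lra.
    + apply Rmult_le_compat_r; [lra|]. apply Rsum_term_le; assumption.
  - rewrite H, Cmod_0 by exact Hn.
    apply Rmult_le_pos; [apply Rsum_nonneg; auto | lra].
Qed.

(** With r = sqrt q, the n + 1 terms of 1 + r + ... + r^n are all at least r^n, so (n + 1) r^n <=
    1/(1 - r). Squaring gives decay like (n + 1)^(-2), which suffices because a <= 1. *)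
Lemma decay_geometric (a q : R) : a <= 1 -> 0 < q < 1 ->
  exists K, decay a K (fun n => RtoC (q ^ n)).
Proof.
  intros Ha Hq. set (r := sqrt q).
  assert (Hr : 0 < r < 1).
  { split; [apply sqrt_lt_R0; lra|]. rewrite <- sqrt_1. apply sqrt_lt_1; lra. }
  assert (Hrr : r * r = q) by (apply sqrt_sqrt; lra).
  assert (G : forall n, INR (S n) * r ^ n * (1 - r) <= 1 - r ^ S n).
  { induction n as [|n IH]; [simpl; lra|].
    rewrite (S_INR (S n)). simpl (r ^ S (S n)). simpl (r ^ S n) in *.
    assert (P : 0 < r ^ n) by (apply pow_lt; lra).
    assert (0 <= r * r ^ n * (1 - r)) by (apply Rmult_le_pos; nra).
    assert (P1 : r ^ n <= 1) by (rewrite <- (pow1 n); apply pow_incr; lra).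
    assert (r * (INR (S n) * r ^ n * (1 - r)) <= r * (1 - r * r ^ n)) by nra.
    assert (r * (1 - r) * r ^ n <= r * (1 - r) * 1) by (apply Rmult_le_compat_l; nra). nra. }
  exists ((/ (1 - r)) ^ 2). intros n.
  rewrite Cmod_R, Rabs_pos_eq by (apply pow_le; lra).
  assert (Hx : 1 <= INR (S n)) by (apply (le_INR 1); lia).
  set (x := INR (S n)) in *.
  assert (P : 0 < r ^ n) by (apply pow_lt; lra).
  assert (G1 : x * r ^ n <= / (1 - r)).
  { apply Rmult_le_reg_r with (1 - r); [lra|]. rewrite Rinv_l by lra.
    specialize (G n). assert (0 < r ^ S n) by (apply pow_lt; lra). fold x in G. lra. }
  assert (W : / x ^ 2 <= wt a n).
  { unfold wt. fold x. rewrite <- (Rpower_pow 2) by lra. rewrite <- Rpower_Ropp.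
    apply Rle_Rpower; [lra|]. simpl. lra. }
  rewrite <- Hrr, Rpow_mult_distr.
  assert (G2 : (x * r ^ n) ^ 2 <= (/ (1 - r)) ^ 2).
  { apply pow_incr. split; [apply Rmult_le_pos; lra | exact G1]. }
  apply Rle_trans with ((x * r ^ n) ^ 2 * / x ^ 2).
  - right. field. lra.
  - apply Rmult_le_compat; [apply pow2_ge_0 | | exact G2 | exact W].
    apply Rlt_le, Rinv_0_lt_compat, pow_lt. lra.
Qed.

Lemma decay_real_series (a K : R) (c : nat -> R) : 0 < a -> decay a K (fun n => RtoC (c n)) ->
  ex_series (fun n => Rabs (c n)).
Proof.
  intros Ha H.
  destruct (ex_finite_lim_seq_incr (sum_n (fun n => Rabs (c n))) (K * (1 + / a))) as [l Hl].
  - intros n. rewrite Rsum_S. assert (P := Rabs_pos (c (S n))). lra.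
  - intros n. eapply Rle_trans; [|apply (decay_sum a K _ n Ha H)].
    right. apply sum_n_ext. intros k. now rewrite Cmod_R.
  - exists l. exact Hl.
Qed.

Lemma conv_PS_mult (b g : nat -> R) (n : nat) :
  RtoC (PS_mult b g n) = conv (fun k => RtoC (b k)) (fun k => RtoC (g k)) n.
Proof.
  unfold PS_mult. rewrite conv_sum, <- sum_n_Reals, <- Csum_RtoC.
  apply sum_n_ext. intros k. now rewrite RtoC_mult.
Qed.

(** The coefficients are the Cauchy product of those of (1 - x)^a with g. The former sum to 0, so by
    absolute convergence the product series does as well; this is omega(1) = 0 in terms of
    coefficients. *)
Lemma binomial_multiple (a K : R) (g : nat -> R) (omega : C -> C) (w : nat -> C) :
  0 < a <= 1 -> decay a K (fun n => RtoC (g n)) ->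
  are_taylor_coefficients omega w ->
  (forall x, Rabs x < 1 -> omega (RtoC x) = RtoC (Rpower (1 - x) a * PSeries g x)) ->
  (exists K', decay a K' w) /\
  is_lim_seq (fun n => Cmod (sum_n w n)) 0.
Proof.
  intros Ha Hg Hw Hom.
  assert (Dc := decay_conv a _ _ _ _ (proj1 Ha) (bcoef_decay a Ha) Hg).
  set (c := PS_mult (bcoef a) g).
  match type of Dc with decay a ?k _ => set (K' := k) in Dc end.
  assert (Dc' : decay a K' (fun n => RtoC (c n))).
  { intros n. unfold c. rewrite conv_PS_mult. apply Dc. }
  assert (E : forall n, w n = RtoC (c n)).
  { apply (taylor_coefficients_real omega w c K' Hw).
    - intros n. rewrite <- Cmod_R. apply (decay_bounded a K' _ n (proj1 Ha) Dc').
    - intros x Hx. rewrite Hom by exact Hx. f_equal. unfold c.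
      rewrite PSeries_mult.
      + now rewrite PSeries_bcoef.
      + apply (bounded_inside_radius _ 2); [|exact Hx]. intros n. apply bcoef_bounded, Ha.
      + apply (bounded_inside_radius _ K); [|exact Hx]. intros n. rewrite <- Cmod_R.
        apply (decay_bounded a K _ n (proj1 Ha) Hg). }
  split.
  - exists K'. intros n. rewrite E. apply Dc'.
  - assert (Sg := decay_real_series a K g (proj1 Ha) Hg).
    assert (Sb := decay_real_series a _ _ (proj1 Ha) (bcoef_decay a Ha)).
    destruct (ex_series_Rabs g Sg) as [lg Hlg].
    assert (Hb : is_series (bcoef a) 0).
    { assert (L : is_lim_seq (sum_n (bcoef a)) 0).
      { apply (is_lim_seq_ext (bsum a)); [|apply bsum_lim, Ha].
        intros n. symmetry. apply bcoef_sum. }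
      exact L. }
    assert (Hc := is_series_mult _ _ _ _ Hb Hlg Sb Sg). rewrite Rmult_0_l in Hc.
    apply (is_lim_seq_ext (fun n => Rabs (sum_n c n))).
    + intros n. rewrite <- Cmod_R, <- Csum_RtoC. f_equal.
      apply sum_n_ext. intros k. now rewrite E.
    + assert (L := is_lim_seq_abs (sum_n c) 0 Hc). simpl in L. rewrite Rabs_R0 in L. exact L.
Qed.

Lemma PSeries_linear (u v x : R) :
  PSeries (fun n => match n with 0%nat => u | 1%nat => v | _ => 0 end) x = u + v * x.
Proof.
  set (g := fun n : nat => match n with 0%nat => u | 1%nat => v | _ => 0 end).
  assert (H : forall n, sum_n (fun k => x ^ k * g k) (S n) = u + v * x).
  { induction n as [|n IH]; rewrite Rsum_S.
    - rewrite sum_O. simpl. ring.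
    - rewrite IH. simpl. ring. }
  apply is_pseries_unique. unfold is_pseries, is_series.
  eapply filterlim_ext_loc; [|apply filterlim_const].
  exists 1%nat. intros [|n] Hn; [lia|]. symmetry. exact (H n).
Qed.

Lemma generating_coefficients (fam : gen_family) (p : nat) (alpha : R)
    (omega : C -> C) (w : nat -> C) :
  0 < alpha <= 1 -> (p = 1%nat \/ p = 2%nat) ->
  is_generating_function fam p alpha omega -> are_taylor_coefficients omega w ->
  (exists K, decay alpha K w) /\ is_lim_seq (fun n => Cmod (sum_n w n)) 0.
Proof.
  intros Ha Hp Hg Hw.
  assert (Hreal := fun x => generating_function_real fam p alpha omega x Hp Hg).
  (* The cofactor of (1 - x)^alpha is linear for order 1 and for Newton-Gregory of order 2; only the
     backward difference formula of order 2 has a cofactor given by an infinite series. *)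
  assert (Hlin : forall u v, (forall x, Rabs x < 1 ->
      real_symbol fam p alpha x = Rpower (1 - x) alpha * (u + v * x)) ->
    (exists K, decay alpha K w) /\ is_lim_seq (fun n => Cmod (sum_n w n)) 0).
  { intros u v H. set (g := fun n => match n with 0%nat => u | 1%nat => v | _ => 0 end).
    destruct (decay_finite alpha (fun n => RtoC (g n)) 1) as [K HK].
    { intros [|[|n]] Hn; [lia|lia|reflexivity]. }
    apply (binomial_multiple alpha K g omega w Ha HK Hw).
    intros x Hx. rewrite Hreal, H by exact Hx. unfold g. now rewrite PSeries_linear. }
  assert (H1 : (forall x, real_symbol fam p alpha x = Rpower (1 - x) alpha) ->
    (exists K, decay alpha K w) /\ is_lim_seq (fun n => Cmod (sum_n w n)) 0).
  { intros H. apply (Hlin 1 0). intros x _. rewrite H. ring. }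
  destruct Hp as [-> | ->]; [apply H1; intros x; destruct fam; reflexivity|].
  destruct fam; [|apply (Hlin (1 + alpha / 2) (- alpha / 2));
    intros x _; unfold real_symbol, Rdiv; ring].
  (* [(1 - x) (3 - x) / 2 = (3 / 2) (1 - x) (1 - x / 3)] *)
  set (C0 := Rpower (3 / 2) alpha).
  assert (HC0 : 0 < C0) by apply Rpower_pos.
  set (g := fun n => C0 * (bcoef alpha n * (/ 3) ^ n)).
  assert (HK : decay alpha (C0 * Rpower 2 (1 + alpha)) (fun n => RtoC (g n))).
  { intros n. assert (B := bcoef_decay alpha Ha n). cbv beta in B. rewrite Cmod_R in B |- *.
    unfold g. rewrite !Rabs_mult, (Rabs_pos_eq C0) by lra.
    rewrite Rmult_assoc. apply Rmult_le_compat_l; [lra|].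
    assert (Q : 0 <= (/ 3) ^ n <= 1).
    { split; [apply pow_le; lra|]. rewrite <- (pow1 n). apply pow_incr. lra. }
    rewrite (Rabs_pos_eq ((/ 3) ^ n)) by apply Q.
    eapply Rle_trans; [apply Rmult_le_compat_l; [apply Rabs_pos | apply Q]|].
    rewrite Rmult_1_r. exact B. }
  apply (binomial_multiple alpha _ g omega w Ha HK Hw).
  intros x Hx. rewrite Hreal by exact Hx. f_equal.
  assert (Hx' := Rabs_def2 _ _ Hx).
  assert (E : PSeries g x = C0 * Rpower (1 - / 3 * x) alpha).
  { rewrite <- (PSeries_bcoef alpha (/ 3 * x)); [|exact Ha|apply Rabs_def1; lra].
    unfold PSeries. rewrite <- Series_scal_l. apply Series_ext. intros n.
    unfold g. rewrite Rpow_mult_distr. ring. }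
  rewrite E. unfold real_symbol, C0.
  rewrite !Rpower_mult_distr by lra. f_equal. field.
Qed.

(** * Stability *)

(** Convolution with a summable sequence preserves null sequences: for the first N2 entries of [e]
    the factor from [f] is small, and the rest of [e] is a small tail against a bounded [f]. *)
Lemma conv_null (e f : nat -> C) (E : R) :
  (forall N, sum_n (fun n => Cmod (e n)) N <= E) ->
  is_lim_seq (fun n => Cmod (f n)) 0 ->
  is_lim_seq (fun n => Cmod (conv e f n)) 0.
Proof.
  intros HE Hf.
  assert (HE0 : 0 <= E).
  { eapply Rle_trans; [|apply (HE 0%nat)]. rewrite sum_O. apply Cmod_ge_0. }
  assert (HB : exists B, 0 <= B /\ forall n, Cmod (f n) <= B).
  { destruct (filterlim_bounded (fun n => Cmod (f n))) as [B HB].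
    - exists 0. exact Hf.
    - exists B. assert (A : forall n, Cmod (f n) <= B).
      { intros n. eapply Rle_trans; [apply Rle_abs | apply HB]. }
      split; [|exact A]. eapply Rle_trans; [apply Cmod_ge_0 | apply (A 0%nat)]. }
  destruct HB as (B & HB0 & HB).
  apply is_lim_seq_spec in Hf. apply is_lim_seq_spec. intros eps.
  assert (Heps := cond_pos eps).
  set (e1 := eps / (2 * (E + 1))). set (e2 := eps / (4 * (B + 1))).
  assert (He1 : 0 < e1) by (apply Rdiv_lt_0_compat; lra).
  assert (He2 : 0 < e2) by (apply Rdiv_lt_0_compat; lra).
  destruct (Hf (mkposreal e1 He1)) as [N1 HN1]. simpl in HN1.
  destruct (summable_tail (fun n => Cmod (e n)) E (fun n => Cmod_ge_0 _) HE e2 He2)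
    as [N2 HN2].
  (* For j <= N2 this forces n - j >= N1. The two parts then add up to at most 3/4 of eps. *)
  exists (N1 + N2)%nat. intros n Hn.
  rewrite Rminus_0_r, Rabs_pos_eq by apply Cmod_ge_0.
  eapply Rle_lt_trans; [apply conv_Cmod|].
  assert (Hsplit : sum_n (fun j => Cmod (e j) * Cmod (f (n - j)%nat)) n
    <= e1 * sum_n (fun j => Cmod (e j)) N2
       + B * (sum_n (fun j => Cmod (e j)) n - sum_n (fun j => Cmod (e j)) N2)).
  { assert (G : forall m, (N2 <= m)%nat ->
      sum_n (fun j => Cmod (e j) * Cmod (f (n - j)%nat)) m
      <= e1 * sum_n (fun j => Cmod (e j)) N2
       + B * (sum_n (fun j => Cmod (e j)) m - sum_n (fun j => Cmod (e j)) N2)).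
    { intros m Hm. induction Hm as [|m Hm IH].
      - replace (sum_n (fun j => Cmod (e j)) N2 - sum_n (fun j => Cmod (e j)) N2)
          with 0 by (symmetry; apply Rminus_diag).
        rewrite Rmult_0_r, Rplus_0_r, <- Rsum_scal. apply Rsum_le.
        intros j Hj. rewrite Rmult_comm. apply Rmult_le_compat_r; [apply Cmod_ge_0|].
        specialize (HN1 (n - j)%nat ltac:(lia)).
        rewrite Rminus_0_r, Rabs_pos_eq in HN1 by apply Cmod_ge_0. lra.
      - rewrite !Rsum_S.
        assert (P := Cmod_ge_0 (e (S m))). specialize (HB (n - S m)%nat). nra. }
    apply G. lia. }
  eapply Rle_lt_trans; [exact Hsplit|].
  assert (T := HN2 N2 n (Nat.le_refl _) ltac:(lia)).
  assert (X1 : e1 * sum_n (fun j => Cmod (e j)) N2 <= eps / 2).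
  { apply Rle_trans with (e1 * E); [apply Rmult_le_compat_l; [lra | apply HE]|].
    unfold e1. apply Rmult_le_reg_r with (2 * (E + 1)); [lra|].
    replace (eps / (2 * (E + 1)) * E * (2 * (E + 1))) with (eps * E) by (field; lra). nra. }
  assert (X2 : B * (sum_n (fun j => Cmod (e j)) n - sum_n (fun j => Cmod (e j)) N2)
               <= eps / 4).
  { apply Rle_trans with (B * e2); [apply Rmult_le_compat_l; assumption|].
    unfold e2. apply Rmult_le_reg_r with (4 * (B + 1)); [lra|].
    replace (B * (eps / (4 * (B + 1))) * (4 * (B + 1))) with (eps * B) by (field; lra). nra. }
  lra.
Qed.

(** The energy bound tested on the unit sequence. It supplies the nonzero leading coefficient needed
    for a formal inverse. *)
Lemma coercive_head (D : nat -> C) (c : R) : coercive D c -> c <= Re (D 0%nat).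
Proof.
  intros HD. assert (H := coercive_energy D delta0 c 0 HD).
  rewrite !sum_O in H. simpl in H. rewrite Cmod_1 in H. unfold Re. lra.
Qed.

(** With e the inverse of the convolution of g and d, u is e convolved with g convolved with d u.
    Both e and g are summable, so null sequences are preserved twice. *)
Lemma coercive_stable (a K K' c : R) (d g u : nat -> C) :
  0 < a <= 1 -> 0 < c -> decay a K d -> decay a K' g -> coercive (conv g d) c ->
  is_lim_seq (fun n => Cmod (conv d u n)) 0 ->
  is_lim_seq (fun n => Cmod (u n)) 0.
Proof.
  intros Ha Hc Hd Hg HD Hf.
  assert (HD0 : conv g d 0%nat <> RtoC 0).
  { intros E. assert (H := coercive_head _ _ HD). rewrite E in H. simpl in H. lra. }
  destruct (conv_solve (conv g d) delta0 HD0) as [e He].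
  destruct (inverse_summable (conv g d) e a _ c Ha Hc
    (decay_conv a _ _ _ _ (proj1 Ha) Hg Hd) HD He) as [E HE].
  assert (L1 := conv_null g _ _ (fun N => decay_sum a K' g N (proj1 Ha) Hg) Hf).
  assert (L2 := conv_null e _ _ HE L1).
  eapply is_lim_seq_ext; [|exact L2]. intros n. cbv beta. f_equal.
  transitivity (conv e (conv (conv g d) u) n).
  { apply conv_ext; [reflexivity|]. intros. symmetry. apply conv_assoc. }
  rewrite <- conv_assoc, (conv_ext _ delta0 u u);
    [apply conv_delta_l | intros; now rewrite conv_comm | reflexivity].
Qed.

(** * The method as a convolution equation *)

Definition difference_coef (q n : nat) : C :=
  match q, n with
  | 1%nat, 0%nat => 1
  | 1%nat, 1%nat => RtoC (-1)
  | 2%nat, 0%nat => 1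
  | 2%nat, 1%nat => RtoC (-2)
  | 2%nat, 2%nat => 1
  | _, _ => RtoC 0
  end.

Lemma conv_zero_l (a b : nat -> C) (n : nat) :
  (forall k, a k = RtoC 0) -> conv a b n = RtoC 0.
Proof.
  intros H. rewrite conv_sum. apply Csum_zero. intros k _. rewrite H. ring.
Qed.

Lemma difference_conv (q n : nat) (u : nat -> C) :
  (q = 1%nat \/ q = 2%nat) -> (q <= n)%nat ->
  conv (difference_coef q) u n = perturbation q n u.
Proof.
  intros [-> | ->] Hn.
  - destruct n as [|[|n]]; [lia|simpl; ring|].
    simpl. rewrite conv_zero_l by reflexivity. ring.
  - destruct n as [|[|[|n]]]; [lia|lia|simpl; ring|].
    simpl. rewrite conv_zero_l by reflexivity. ring.
Qed.

Lemma difference_ev (q n : nat) (z : C) :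
  (q = 1%nat \/ q = 2%nat) -> (2 <= n)%nat ->
  ev (difference_coef q) n z = ((1 - z) ^ q)%C.
Proof.
  intros Hq Hn. rewrite (ev_trunc _ 2) by (exact Hn || (intros [|[|[|k]]] Hk; try lia;
    destruct Hq as [-> | ->]; reflexivity)).
  unfold ev. rewrite !Csum_S, sum_O. destruct Hq as [-> | ->]; simpl; carrier_ring.
Qed.

(* Coefficients of [omega(z) + T (mu + k (1 - z)^q)]. *)
Definition method_coef (w : nat -> C) (T mu k : R) (q n : nat) : C :=
  (w n + RtoC T * (RtoC mu * delta0 n + RtoC k * difference_coef q n))%C.

Lemma conv_one_l (w : nat -> C) (n : nat) : conv (fun _ => RtoC 1) w n = sum_n w n.
Proof.
  rewrite conv_comm, conv_sum. apply sum_n_ext. intros. carrier_ring.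
Qed.

(** The U_0 subtracted inside the memory sum becomes the right-hand side. Rows below [q] are not
    equations of the method; they are left to the starting values. *)
Lemma method_conv (q : nat) (alpha lambda rho kappa tau : R) (w u : nat -> C) :
  (q = 1%nat \/ q = 2%nat) ->
  satisfies_method q alpha lambda rho kappa w tau u <->
  forall n, (q <= n)%nat ->
    conv (method_coef w (Rpower tau alpha) (- (lambda + rho)) (rho + kappa) q) u n
    = (u 0%nat * sum_n w n)%C.
Proof.
  intros Hq. set (T := Rpower tau alpha).
  assert (HT : T <> 0) by (apply Rgt_not_eq, Rpower_pos).
  assert (HTC : RtoC T <> RtoC 0) by (intros E; now apply HT, RtoC_inj).
  assert (Hl : forall n, sum_n (fun j => w (n - j)%nat * (u j - u 0%nat))%C n
             = (conv w u n - u 0%nat * sum_n w n)%C).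
  { intros n. rewrite <- (conv_one_l w), (conv_comm w u), !conv_sum.
    transitivity (sum_n (fun j => u j * w (n - j)%nat
                             + - u 0%nat * (1 * w (n - j)%nat))%C n).
    - apply sum_n_ext. intros j. carrier_ring.
    - rewrite Csum_plus, (Csum_scal (- u 0%nat)%C). carrier_ring. }
  assert (Hr : forall n, (q <= n)%nat ->
    conv (method_coef w T (- (lambda + rho)) (rho + kappa) q) u n
    = (conv w u n + RtoC T * (RtoC (- (lambda + rho)) * u n
        + RtoC (rho + kappa) * perturbation q n u))%C).
  { intros n Hn. unfold method_coef.
    rewrite (conv_plus_l w), conv_scal_l,
      (conv_plus_l (fun k => RtoC (- (lambda + rho)) * delta0 k)%C), !conv_scal_l.
    rewrite conv_delta_l. change (fun k => difference_coef q k) with (difference_coef q).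
    rewrite difference_conv by assumption. reflexivity. }
  split; intros H n Hn; specialize (H n Hn).
  - rewrite Hl in H. rewrite Hr by exact Hn.
    apply (f_equal (fun x => RtoC T * x)%C) in H.
    fold T in H. rewrite RtoC_inv, Cmult_assoc, Cinv_r, Cmult_1_l in H by assumption.
    rewrite RtoC_opp.
    replace (conv w u n) with ((conv w u n - u 0%nat * sum_n w n) + u 0%nat * sum_n w n)%C
      by carrier_ring.
    rewrite H. carrier_ring.
  - rewrite Hl. rewrite Hr in H by exact Hn. rewrite RtoC_opp in H.
    fold T. rewrite RtoC_inv by exact HT.
    replace (conv w u n - u 0%nat * sum_n w n)%C
      with (RtoC T * (RtoC (lambda + rho) * u n - RtoC (rho + kappa) * perturbation q n u))%C.
    + rewrite Cmult_assoc, Cinv_l, Cmult_1_l by exact HTC. reflexivity.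
    + rewrite <- H. carrier_ring.
Qed.

Definition method_symbol (omega : C -> C) (T mu k : R) (q : nat) (z : C) : C :=
  (omega z + RtoC T * (RtoC mu + RtoC k * (1 - z) ^ q))%C.

Lemma method_coef_decay (a K T mu k : R) (w : nat -> C) (q : nat) :
  decay a K w -> exists K', decay a K' (method_coef w T mu k q).
Proof.
  intros Hw.
  destruct (decay_finite a (fun n => RtoC T * (RtoC mu * delta0 n
     + RtoC k * difference_coef q n))%C 2) as [K' HK'].
  - intros [|[|[|n]]] Hn; try lia.
    destruct q as [|[|[|q]]]; simpl; ring.
  - exists (K + K'). apply (decay_plus a K K'); assumption.
Qed.

Lemma method_series (omega : C -> C) (w : nat -> C) (T mu k : R) (q : nat) (z : C) :
  (q = 1%nat \/ q = 2%nat) -> are_taylor_coefficients omega w -> Cmod z < 1 ->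
  is_pseries (K := C_AbsRing) (V := C_NormedModule)
    (method_coef w T mu k q) z (method_symbol omega T mu k q z).
Proof.
  intros Hq Hw Hz. apply is_pseries_ev. intros eps Heps.
  specialize (Hw z Hz). apply is_pseries_ev with (eps := eps) in Hw; [|exact Heps].
  destruct Hw as [N HN]. exists (N + 2)%nat. intros n Hn.
  specialize (HN n ltac:(lia)). unfold method_coef, method_symbol.
  rewrite (ev_plus w), ev_scal, (ev_plus (fun j => RtoC mu * delta0 j)%C), !ev_scal.
  change (fun j => difference_coef q j) with (difference_coef q).
  rewrite difference_ev by (assumption || lia).
  rewrite (ev_trunc delta0 0 n) by (lia || (intros [|j] Hj; [lia|reflexivity])).
  unfold ev at 2. rewrite sum_O. simpl delta0. simpl (z ^ 0)%C.
  replace (ev w n z + RtoC T * (RtoC mu * (1 * 1) + RtoC k * (1 - z) ^ q) -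
    (omega z + RtoC T * (RtoC mu + RtoC k * (1 - z) ^ q)))%C with (ev w n z - omega z)%C by ring.
  exact HN.
Qed.

(* Needed when [q = 2] and [rho + kappa] is large: the real part of the symbol
   itself then takes negative values. *)
Lemma coercive_divided (a K eps c : R) (d : nat -> C) (F : C -> C) :
  0 < a <= 1 -> 0 < eps -> 0 < c -> decay a K d ->
  (forall z, Cmod z < 1 -> is_pseries (K := C_AbsRing) (V := C_NormedModule) d z (F z)) ->
  (forall z, Cmod z < 1 -> c <= Re (F z * Cconj (RtoC eps + (1 - z)))%C) ->
  exists g K' c', 0 < c' /\ decay a K' g /\ coercive (conv g d) c'.
Proof.
  intros Ha Heps Hc Hd HF Hpos.
  (* 1/(1 + eps - z) = r/(1 - r z), whose coefficients r^(n+1) form the sequence [g] below. *)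
  set (r := / (1 + eps)).
  assert (Hr : 0 < r < 1).
  { split; [apply Rinv_0_lt_compat; lra|]. rewrite <- Rinv_1.
    apply Rinv_lt_contravar; lra. }
  destruct (decay_geometric a r (proj2 Ha) Hr) as [Kg HKg].
  set (g := fun n => (RtoC r * RtoC (r ^ n))%C).
  assert (Hg : decay a (Cmod (RtoC r) * Kg) g) by (apply decay_scal; exact HKg).
  (* Re(F/m) = Re(F conj(m)) / |m|^2 with m = 1 + eps - z, and |m| <= 2 + eps on the disc. *)
  exists g, (Cmod (RtoC r) * Kg), (c / (2 + eps) ^ 2).
  assert (H2 : 0 < (2 + eps) ^ 2) by (apply pow_lt; lra).
  split; [apply Rdiv_lt_0_compat; lra|]. split; [exact Hg|].
  set (D := conv g d).
  assert (HD := decay_conv a _ _ _ _ (proj1 Ha) Hg Hd). fold D in HD.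
  match type of HD with decay a ?k _ => set (KD := k) in HD end.
  set (m := fun n => match n with
                     | 0%nat => RtoC (1 + eps) | 1%nat => RtoC (-1) | _ => RtoC 0 end).
  assert (Hmg : forall n, conv m g n = delta0 n).
  { intros [|[|n]]; simpl; unfold g.
    - rewrite <- !RtoC_mult. f_equal. unfold r. simpl. field. lra.
    - rewrite <- !RtoC_mult, <- RtoC_plus. f_equal. unfold r. simpl. field. lra.
    - rewrite conv_zero_l by reflexivity.
      rewrite Cplus_0_r, <- !RtoC_mult, <- RtoC_plus. f_equal. simpl.
      unfold r. field_simplify; [|lra]. unfold Rdiv. ring. }
  assert (Hmd : forall n, conv m D n = d n).
  { intros n. unfold D. rewrite <- conv_assoc.
    rewrite (conv_ext _ delta0 d d) by auto. apply conv_delta_l. }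
  (* Multiplying a partial sum of D by 1 + eps - z gives that of d up to one boundary term, which
     tends to 0 because D is summable. *)
  assert (Hev : forall n z, ev d n z
     = ((RtoC eps + (1 - z)) * ev D n z + z ^ S n * D n)%C).
  { intros n z. induction n as [|n IH].
    - unfold ev. rewrite !sum_O, <- Hmd. simpl. rewrite RtoC_plus. ring.
    - unfold ev in *. rewrite !Csum_S, IH, <- Hmd.
      replace (conv m D (S n)) with (RtoC (1 + eps) * D (S n) + RtoC (-1) * D n)%C.
      + rewrite RtoC_plus, (Cpow_S z (S n)). carrier_ring.
      + simpl conv. destruct n as [|n]; [reflexivity|]. simpl conv.
        rewrite conv_zero_l by reflexivity. ring. }
  set (mz := fun z : C => (RtoC eps + (1 - z))%C).
  assert (Hm : forall z, Cmod z < 1 -> eps <= Cmod (mz z) <= 2 + eps).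
  { intros z Hz. split.
    - assert (P := re_le_Cmod (mz z)). assert (Q := unit_disc_shift_Re z Hz).
      assert (E : Re (mz z) = eps + Re (1 - z)%C) by reflexivity.
      assert (X := Rle_abs (Re (mz z))). lra.
    - unfold mz. eapply Rle_trans; [apply Cmod_triangle|].
      rewrite Cmod_R, Rabs_pos_eq by lra.
      assert (Cmod (1 - z)%C <= 2); [|lra].
      eapply Rle_trans; [apply Cmod_triangle|]. rewrite Cmod_opp, Cmod_1. lra. }
  apply (coercive_of_series D (fun z => F z / mz z)%C (KD * (1 + / a))).
  - intros N. apply decay_sum; [lra|exact HD].
  - intros z Hz. destruct (Hm z Hz) as [Hm1 Hm2].
    assert (Hm0 : mz z <> RtoC 0) by (apply Cmod_gt_0; lra).
    apply is_pseries_ev. intros e He.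
    (* The factor [eps] in the tolerances compensates for the division by a number of modulus at
       least [eps]. *)
    assert (F1 := HF z Hz). apply is_pseries_ev with (eps := eps * e / 2) in F1; [|nra].
    destruct F1 as [N1 HN1].
    destruct (summable_tail (fun n => Cmod (D n)) (KD * (1 + / a)) (fun n => Cmod_ge_0 _)
      (fun N => decay_sum a KD D N (proj1 Ha) HD) (eps * e / 4)) as [N2 HN2]; [nra|].
    exists (S (N1 + N2)). intros [|n] Hn; [lia|].
    specialize (HN1 (S n) ltac:(lia)). specialize (HN2 n (S n) ltac:(lia) ltac:(lia)).
    rewrite Rsum_S in HN2.
    replace (ev D (S n) z - F z / mz z)%C
      with (((ev d (S n) z - F z) + - (z ^ S (S n) * D (S n))) / mz z)%C.
    2: { rewrite Hev. fold (mz z). field. exact Hm0. }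
    rewrite Cmod_div by exact Hm0.
    apply Rmult_lt_reg_r with (Cmod (mz z)); [lra|].
    unfold Rdiv. rewrite Rmult_assoc, Rinv_l, Rmult_1_r by lra.
    eapply Rle_lt_trans; [apply Cmod_triangle|].
    rewrite Cmod_opp, Cmod_mult, Cmod_pow.
    assert (Q : 0 <= Cmod z ^ S (S n) <= 1).
    { split; [apply pow_le, Cmod_ge_0|]. rewrite <- (pow1 (S (S n))).
      apply pow_incr. split; [apply Cmod_ge_0 | lra]. }
    assert (P := Cmod_ge_0 (D (S n))).
    assert (X : Cmod (D (S n)) <= eps * e / 4) by lra.
    assert (Cmod z ^ S (S n) * Cmod (D (S n)) <= eps * e / 4) by nra.
    assert (eps * e <= e * Cmod (mz z)) by nra. nra.
  - intros z Hz. destruct (Hm z Hz) as [Hm1 Hm2]. specialize (Hpos z Hz). fold (mz z) in Hpos.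
    assert (Hm0 : mz z <> RtoC 0) by (apply Cmod_gt_0; lra).
    assert (E : Re (F z / mz z)%C = Re (F z * Cconj (mz z))%C / Cmod (mz z) ^ 2).
    { assert (Y : Cmod (mz z) ^ 2 <> 0) by (apply Rgt_not_eq, pow_lt; lra).
      rewrite Cmod2_alt in *. destruct (F z) as [r0 r1], (mz z) as [r2 r3]; simpl in *. field.
      replace (r2 * r2 + r3 * r3) with (r2 * (r2 * 1) + r3 * (r3 * 1)) by ring. exact Y. }
    rewrite E.
    assert (Hsq : 0 < Cmod (mz z) ^ 2 <= (2 + eps) ^ 2).
    { split; [apply pow_lt; lra|]. apply pow_incr. lra. }
    unfold Rdiv. apply Rmult_le_compat; [lra| |exact Hpos|].
    + apply Rlt_le, Rinv_0_lt_compat, H2.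
    + apply Rinv_le_contravar; lra.
Qed.

Lemma coercive_undivided (a K c : R) (d : nat -> C) (F : C -> C) :
  0 < a <= 1 -> 0 < c -> decay a K d ->
  (forall z, Cmod z < 1 -> is_pseries (K := C_AbsRing) (V := C_NormedModule) d z (F z)) ->
  (forall z, Cmod z < 1 -> c <= Re (F z)) ->
  exists g K' c', 0 < c' /\ decay a K' g /\ coercive (conv g d) c'.
Proof.
  intros Ha Hc Hd HF Hpos.
  destruct (decay_finite a delta0 0) as [K' HK'].
  { intros [|n] Hn; [lia|reflexivity]. }
  exists delta0, K', c. split; [exact Hc|]. split; [exact HK'|].
  intros e He.
  destruct (coercive_of_series d F (K * (1 + / a)) c
    (fun N => decay_sum a K d N (proj1 Ha) Hd) HF Hpos e He) as [K0 H].
  exists K0. intros k z Hk Hz.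
  rewrite (ev_ext (conv delta0 d) d) by (intros; apply conv_delta_l). now apply H.
Qed.

(** Write y = 1 - z. The contribution of omega has nonnegative real part, so the task is to bound mu
    + k y^q from below, given |y|^2 < 2 Re y and hence Re y < 2. *)
Lemma method_coercive (omega : C -> C) (w : nat -> C) (a K T mu k : R) (q : nat) :
  0 < a <= 1 -> 0 < T -> 0 < mu -> (q = 1%nat \/ q = 2%nat) ->
  (q = 1%nat -> - mu < 2 * k) -> (q = 2%nat -> - mu < 4 * k) ->
  decay a K w -> are_taylor_coefficients omega w ->
  (forall z, Cmod z < 1 -> 0 <= Re (omega z) /\ 0 <= Re (omega z * Cconj (1 - z))%C) ->
  exists g K' c', 0 < c' /\ decay a K' g /\ coercive (conv g (method_coef w T mu k q)) c'.
Proof.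
  intros Ha HT Hmu Hq Hk1 Hk2 Hw Hom Hsec.
  destruct (method_coef_decay a K T mu k w q Hw) as [Kd Hd].
  assert (HF := fun z => method_series omega w T mu k q z Hq Hom).
  assert (Hre : forall z, Re (method_symbol omega T mu k q z)
      = Re (omega z) + T * (mu + k * Re ((1 - z) ^ q)%C)).
  { intros z. unfold method_symbol. destruct (omega z), ((1 - z) ^ q)%C. simpl. ring. }
  assert (Hy : forall z, Cmod z < 1 -> 0 < Re (1 - z)%C < 2 /\
     Re ((1 - z) ^ 2)%C <= Cmod (1 - z)%C ^ 2 <= 2 * Re (1 - z)%C).
  { intros z Hz. assert (H1 := unit_disc_shift z Hz). assert (H2 := unit_disc_shift_Re z Hz).
    assert (H3 := re_le_Cmod (1 - z)%C).
    assert (H4 := Rle_abs (Re (1 - z)%C)).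
    assert (H5 := Cmod_ge_0 (1 - z)%C).
    assert (H6 : Re (1 - z)%C < 2) by nra.
    repeat split; try lra. rewrite Cmod2_alt. destruct (1 - z)%C as [u v]. simpl. nra. }
  (* For k <= 0 the bounds Re y < 2 and Re (y^2) <= |y|^2 < 4 leave mu + 2k or mu + 4k. For k > 0
     and q = 1 the bound is mu; for q = 2, Re (y^2) can be negative and the division is used. *)
  destruct (Rle_lt_dec k 0) as [Hk|Hk].
  - apply (coercive_undivided a Kd (T * Rmin (mu + 2 * k) (if Nat.eq_dec q 2 then mu + 4 * k else mu))
      _ (method_symbol omega T mu k q) Ha); [|exact Hd|exact HF|].
    + apply Rmult_lt_0_compat; [exact HT|]. apply Rmin_pos.
      * destruct Hq as [Hq|Hq]; [specialize (Hk1 Hq)|specialize (Hk2 Hq)]; lra.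
      * destruct (Nat.eq_dec q 2) as [E|E]; [specialize (Hk2 E)|]; lra.
    + intros z Hz. rewrite Hre. destruct (Hsec z Hz) as [S1 _].
      destruct (Hy z Hz) as [Y1 Y2].
      apply Rle_trans with (T * (mu + k * Re ((1 - z) ^ q)%C)); [|lra].
      apply Rmult_le_compat_l; [lra|].
      destruct Hq as [-> | ->].
      * eapply Rle_trans; [apply Rmin_l|]. rewrite Cpow_1_r. nra.
      * eapply Rle_trans; [apply Rmin_r|]. destruct (Nat.eq_dec 2 2) as [_|E]; [|lia].
        nra.
  - destruct Hq as [-> | ->].
    + apply (coercive_undivided a Kd (T * mu) _ (method_symbol omega T mu k 1) Ha);
        [nra|exact Hd|exact HF|].
      intros z Hz. rewrite Hre, Cpow_1_r. destruct (Hsec z Hz) as [S1 _].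
      destruct (Hy z Hz) as [Y1 _].
      assert (0 <= T * (k * Re (1 - z)%C)) by (apply Rmult_le_pos; nra). lra.
    (* Chosen so that the only negative term satisfies k eps |y|^2 <= 2 k eps Re y = mu Re y; it is
       absorbed and mu eps remains. *)
    + set (eps := mu / (2 * k)).
      assert (He : 0 < eps) by (apply Rdiv_lt_0_compat; lra).
      assert (Hke : 2 * k * eps = mu) by (unfold eps; field; lra).
      apply (coercive_divided a Kd eps (T * (mu * eps)) _ (method_symbol omega T mu k 2) Ha He);
        [|exact Hd|exact HF|].
      * apply Rmult_lt_0_compat; [exact HT | nra].
      * intros z Hz. destruct (Hsec z Hz) as [S1 S2]. destruct (Hy z Hz) as [Y1 Y2].
        unfold method_symbol. set (y := (1 - z)%C) in *.
        (* [Re (y^2 conj y) = |y|^2 Re y], [Re y^2 = 2 (Re y)^2 - |y|^2] *)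
        replace (Re ((omega z + RtoC T * (RtoC mu + RtoC k * y ^ 2)) * Cconj (RtoC eps + y))%C)
          with (Re (omega z * Cconj y)%C + eps * Re (omega z)
             + T * (mu * (Re y + eps) + k * (Cmod y ^ 2 * Re y
                  + eps * (2 * Re y ^ 2 - Cmod y ^ 2)))).
        -- assert (0 <= eps * Re (omega z)) by nra.
           assert (X : mu * eps <= mu * (Re y + eps) + k * (Cmod y ^ 2 * Re y
                  + eps * (2 * Re y ^ 2 - Cmod y ^ 2))).
           { assert (A1 : 0 <= k * (Cmod y ^ 2 * Re y)).
             { apply Rmult_le_pos; [lra|]. apply Rmult_le_pos; [apply pow2_ge_0|lra]. }
             assert (A2 : 0 <= k * eps * (2 * Re y ^ 2)).
             { apply Rmult_le_pos; [nra|]. assert (0 <= Re y ^ 2) by apply pow2_ge_0. lra. }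
             assert (A3 : k * eps * Cmod y ^ 2 <= k * eps * (2 * Re y)).
             { apply Rmult_le_compat_l; [nra | lra]. }
             replace (k * eps * (2 * Re y)) with (mu * Re y) in A3 by (rewrite <- Hke; ring).
             lra. }
           apply (Rmult_le_compat_l T) in X; lra.
        -- rewrite Cmod2_alt. destruct (omega z), y. simpl. ring.
Qed.

Lemma filterlim_Cmod (u : nat -> C) :
  is_lim_seq (fun n => Cmod (u n)) 0 -> filterlim u eventually (locally (RtoC 0)).
Proof.
  intros H. apply is_lim_seq_spec in H.
  apply (filterlim_locally (U := C_UniformSpace)). intros eps.
  destruct (H eps) as [N HN]. exists N. intros n Hn. specialize (HN n Hn).
  rewrite Rminus_0_r, Rabs_pos_eq in HN by apply Cmod_ge_0.
  apply C_NormedModule_mixin_compat1.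
  replace (minus (u n) (RtoC 0)) with (u n); [exact HN|].
  change (u n = u n - RtoC 0)%C. ring.
Qed.

Theorem theorem2p3 :
  forall (fam : gen_family) (p q : nat) (alpha lambda rho kappa : R)
         (omega : C -> C) (w : nat -> C),
    0 < alpha <= 1 ->
    lambda < 0 ->
    rho <= 0 ->
    (p = 1%nat \/ p = 2%nat) ->
    (q = 1%nat \/ q = 2%nat) ->
    is_generating_function fam p alpha omega ->
    are_taylor_coefficients omega w ->
    (q = 1%nat -> kappa > (lambda - rho) / 2) ->
    (q = 2%nat -> kappa > (lambda - 3 * rho) / 4) ->
    unconditionally_stable q alpha lambda rho kappa w.
Proof.
  intros fam p q alpha lambda rho kappa omega w Ha Hl Hrho Hp Hq Hgen Htay Hk1 Hk2 tau Htau.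
  set (T := Rpower tau alpha). set (mu := - (lambda + rho)). set (k := rho + kappa).
  set (d := method_coef w T mu k q).
  destruct (generating_coefficients fam p alpha omega w Ha Hp Hgen Htay) as [[K HK] Hsum].
  destruct (method_coercive omega w alpha K T mu k q) as (g & Kg & c & Hc & Hg & Hco);
    try assumption; try (unfold mu, k; lra).
  { apply Rpower_pos. }
  { intros E. specialize (Hk1 E). unfold mu, k. lra. }
  { intros E. specialize (Hk2 E). unfold mu, k. lra. }
  { intros z Hz. apply (generating_function_sector fam p alpha omega z); assumption. }
  fold d in Hco.
  destruct (method_coef_decay alpha K T mu k w q HK) as [Kd Hd]. fold d in Hd.
  (* d_0 multiplies the unknown U_n, so each implicit step is solvable; it is nonzero since g_0 d_0
     has positive real part. *)
  assert (Hd0 : d 0%nat <> RtoC 0).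
  { intros E. assert (H := coercive_head _ _ Hco). simpl conv in H. rewrite E in H.
    rewrite Cmult_0_r in H. simpl in H. lra. }
  intros start. split.
  (* Rows below [q] are filled with the values that [start] itself produces, so forward substitution
     returns the prescribed starting values. *)
  - set (f := fun n => if Nat.ltb n q then conv d start n else (start 0%nat * sum_n w n)%C).
    destruct (conv_solve d f Hd0) as [u Hu]. exists u.
    assert (Hlt : forall n, (n < q)%nat -> conv d u n = conv d start n).
    { intros n Hn. rewrite Hu. unfold f. destruct (Nat.ltb_spec n q); [reflexivity|lia]. }
    assert (Hcancel : forall x y, (d 0%nat * x = d 0%nat * y)%C -> x = y).
    { intros x y E. apply (f_equal (fun v => / d 0%nat * v)%C) in E.
      rewrite !Cmult_assoc, Cinv_l, !Cmult_1_l in E by exact Hd0. exact E. }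
    assert (H0 : u 0%nat = start 0%nat).
    { apply Hcancel. apply (Hlt 0%nat). destruct Hq; lia. }
    split.
    + intros [|[|i]] Hi; [exact H0| |destruct Hq; lia].
      specialize (Hlt 1%nat Hi). simpl in Hlt. rewrite H0 in Hlt.
      apply Hcancel. replace (d 0%nat * u 1%nat)%C
        with ((d 0%nat * u 1%nat + d 1%nat * start 0%nat) - d 1%nat * start 0%nat)%C by ring.
      rewrite Hlt. ring.
    + apply method_conv; [exact Hq|]. intros n Hn. fold T mu k d.
      rewrite Hu, H0. unfold f. destruct (Nat.ltb_spec n q); [lia|reflexivity].
  - intros u [_ Hm]. assert (Hu := proj1 (method_conv q alpha lambda rho kappa tau w u Hq) Hm).
    fold T mu k d in Hu.
    apply filterlim_Cmod.
    apply (coercive_stable alpha Kd Kg c d g u); try assumption.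
    (* The equation holds from index [q] on, and finitely many rows do not affect the limit. *)
    apply (is_lim_seq_ext_loc (fun n => Cmod (u 0%nat) * Cmod (sum_n w n))).
    + exists q. intros n Hn. now rewrite Hu, Cmod_mult by exact Hn.
    + replace (Finite 0) with (Rbar_mult (Cmod (u 0%nat)) 0)
        by (simpl; now rewrite Rmult_0_r).
      now apply is_lim_seq_scal_l.
Qed.
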